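(* Let $F : L^2(\Omega) \to \mathbb{R}$ be lower semi-continuous and bounded from below. Then there exists a minimizer $\bar{v} \in BV(\Omega)$ of the problem $$\min_{v \in L^2(\Omega)} \; F(v) + \alpha \operatorname{TV}(v) \quad \text{s.t.} \quad v(x) \in \{\nu_1,\ldots,\nu_M\} \text{ for almost all } x \in \Omega. \tag{P}$$
   Context: Let $\alpha > 0$, let $d, M \ge 1$ be integers, let $\Omega \subset \mathbb{R}^d$ be a bounded and connected Lipschitz extension domain, and let $\nu_1 < \cdots < \nu_M$ be integers. For $u \in L^1(\Omega)$, $\operatorname{TV}(u) := \sup\{\int_\Omega u(x)\, \nabla\cdot\phi(x)\,dx : \phi \in C^1_c(\Omega)^d,\ \sup_{s\in\Omega}\|\phi(s)\| \le 1\} \in [0,\infty]$ is the total variation ($\|\cdot\|$ is the Euclidean norm), and $BV(\Omega)$ is the space of $u \in L^1(\Omega)$ with $\operatorname{TV}(u) < \infty$, normed by $\|u\|_{BV} = \|u\|_{L^1(\Omega)} + \operatorname{TV}(u)$. *)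

(* Defs.v *)
From HB Require Import structures.
From mathcomp Require Import all_boot all_order all_algebra.
From mathcomp Require Import all_classical all_reals all_analysis.
From mathcomp Require Import measurable_realfun.

Set Implicit Arguments.
Unset Strict Implicit.
Unset Printing Implicit Defensive.

Import Order.TTheory GRing.Theory Num.Theory.
Import numFieldNormedType.Exports.

Local Open Scope classical_set_scope.
Local Open Scope ring_scope.

Section borel_rV.
Context (R : realType) (n : nat).

Definition borel_rV : set (set 'rV[R]_n) := <<s open >>.

Fact borel_rV_display : measure_display. Proof. exact: default_measure_display. Qed.

HB.instance Definition _ := @isMeasurable.Build borel_rV_display 'rV[R]_n
  borel_rV (@sigma_algebra0 _ setT open)
  (@sigma_algebraC _ open)
  (@sigma_algebra_bigcup _ setT open).

Lemma open_measurable_rV (U : set 'rV[R]_n) : open U -> measurable U.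
Proof. exact: sub_sigma_algebra. Qed.

Lemma continuous_measurable_rV (f : 'rV[R]_n -> R) :
  continuous f -> measurable_fun [set: 'rV[R]_n] f.
Proof.
move=> /continuousP cf.
apply: (@measurability _ _ _ R _ _ (@RGenOpens.G R)).
  exact: RGenOpens.measurableE.
move=> _ [_ [a [b ->] <-]].
rewrite setTI; apply: open_measurable_rV; apply: cf. exact: interval_open.
Qed.

Lemma open_rV_bigcup (U : set 'rV[R]_n) : open U ->
  U = \bigcup_(p in [set p : 'rV[rat]_n * nat |
         ball (map_mx ratr p.1 : 'rV[R]_n) p.2.+1%:R^-1 `<=` U])
       ball (map_mx ratr p.1 : 'rV[R]_n) p.2.+1%:R^-1.
Proof.
move=> oU; apply/seteqP; split=> [x Ux|x [p /= pU /pU//]].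
have /nbhs_ballP[e /= e0 eU] : nbhs x U by exact: open_nbhs_nbhs.
pose k := Num.trunc (e / 2)^-1.
have k0 : (0 : R) < k.+1%:R^-1 by rewrite invr_gt0.
have ke : k.+1%:R^-1 < e / 2.
  by rewrite invf_plt ?posrE ?divr_gt0// Num.Theory.truncnS_gt.
have /choice[q qP] : forall i, exists q : rat, ball (x 0 i) k.+1%:R^-1 (ratr q).
  move=> i.
  have [q] : exists q, ratr q \in `]x 0 i, x 0 i + k.+1%:R^-1[.
    by apply: rat_in_itvoo; rewrite ltrDl.
  rewrite in_itv/= => /andP[xq qx]; exists q.
  by rewrite /ball/= distrC gtr0_norm ?subr_gt0// ltrBlDl.
have bx : ball (map_mx ratr (\row_i q i) : 'rV[R]_n) k.+1%:R^-1 x.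
  by split=> // i j; rewrite ord1 !mxE; apply: ball_sym; exact: qP.
exists (\row_i q i, k) => //= y byy; apply: eU.
apply: (le_ball (ltW _)); last exact: ball_triangle (ball_sym bx) byy.
by rewrite [ltRHS]splitr ltrD.
Qed.

End borel_rV.

Section lebesgue_rV.
Context (R : realType).

Definition cons_rV n (xv : measurableTypeR R * 'rV[R]_n) : 'rV[R]_n.+1 :=
  row_mx (const_mx xv.1 : 'rV_1) xv.2.

Definition uncons_rV n (v : 'rV[R]_n.+1) : measurableTypeR R * 'rV[R]_n :=
  (v 0 0, @rsubmx R 1 1 n v).

Lemma cons_rVK n : cancel (@cons_rV n) (@uncons_rV n).
Proof.
move=> [x v]; rewrite /cons_rV /uncons_rV row_mxKr; congr pair.
rewrite mxE; case: split_ordP => k //= _; first by rewrite mxE.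
Qed.

Lemma uncons_rVK n : cancel (@uncons_rV n) (@cons_rV n).
Proof.
move=> v; apply/rowP => i; rewrite mxE.
case: split_ordP => k ->; rewrite mxE //=; congr (v _ _).
by rewrite ord1; exact/val_inj.
Qed.

Lemma measurable_cons_rV n : measurable_fun setT (@cons_rV n).
Proof.
apply: (@measurability _ _ _ 'rV[R]_n.+1 _ _ open) => // _ [U oU <-].
rewrite setTI (open_rV_bigcup oU) preimage_bigcup bigcup_mkcond.
apply: countable_bigcupT_measurable => // -[q k]; case: ifPn => // _ /=.
have: 0 < k.+1%:R^-1 :> R by rewrite invr_gt0.
move: (map_mx _ _ : 'rV[R]_n.+1) (_^-1) => c e e0.
rewrite (_ : _ @^-1` _ =
    ball (uncons_rV c).1 e `*` ball (uncons_rV c).2 e); last first.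
  apply/seteqP; split=> [[x v] [_ /= cxv]|[x v] [/= cx [_ cv]]].
    have xv0 := congr1 fst (cons_rVK (x, v)).
    have xv1 := congr1 snd (cons_rVK (x, v)).
    split; first by move: xv0 => /= <-; exact: cxv.
    split=> // i j; move: xv1 => /= <-.
    by have := cxv i (rshift 1 j); rewrite !mxE.
  split=> //= i j; rewrite ord1 [X in ball _ _ X]mxE.
  case: split_ordP => k' -> /=; last by have := cv 0 k'; rewrite mxE.
  by rewrite mxE (_ : lshift n k' = 0)//; apply/val_inj; rewrite /= ord1.
apply: measurableX; first exact: measurable_ball.
by apply: open_measurable_rV; exact: ball_open.
Qed.

Lemma measurable_uncons_rV n : measurable_fun setT (@uncons_rV n).
Proof.
apply: measurable_fun_pair => /=.
  by apply: continuous_measurable_rV => v; exact: coord_continuous.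
apply: (@measurability _ _ _ 'rV[R]_n _ _ open) => // _ [U oU <-].
rewrite setTI; apply: open_measurable_rV.
have /continuousP : continuous (@rsubmx R 1 1 n); last exact.
move=> v A /nbhs_ballP[e /= e0 eA]; apply/nbhs_ballP; exists e => //= w [_ vw].
by apply: eA; split=> // i j; rewrite !mxE.
Qed.

HB.instance Definition _ n := isMeasurableFun.Build _ _ _ _
  (@cons_rV n) (@measurable_cons_rV n).

Section pushforward_cons.
Context n (mu : {sigma_finite_measure set 'rV[R]_n -> \bar R}).

Definition cons_measure : set 'rV[R]_n.+1 -> \bar R :=
  pushforward (@lebesgue_measure R \x mu)%E (@cons_rV n).

Let cons_measure0 : cons_measure set0 = 0%E. Proof. exact: measure0. Qed.

Let cons_measure_ge0 A : (0 <= cons_measure A)%E.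
Proof. exact: measure_ge0. Qed.

Let cons_measure_sigma_additive : semi_sigma_additive cons_measure.
Proof. exact: measure_semi_sigma_additive. Qed.

HB.instance Definition _ := isMeasure.Build _ _ _ cons_measure
  cons_measure0 cons_measure_ge0 cons_measure_sigma_additive.

Let sigma_finite_cons : sigma_finite setT cons_measure.
Proof.
have /sigma_finiteP[F [TF ndF Foo]] := sigma_finiteT (@lebesgue_measure R).
have /sigma_finiteP[G [TG ndG Goo]] := sigma_finiteT mu.
exists (fun k => @uncons_rV n @^-1` (F k `*` G k)).
  rewrite -preimage_bigcup -(preimage_setT (@uncons_rV n)); congr (_ @^-1` _).
  apply/seteqP; split=> // -[x v] _.
  have [k _ Fkx] : (\bigcup_k F k) x by rewrite -TF.
  have [l _ Glv] : (\bigcup_k G k) v by rewrite -TG.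
  exists (maxn k l) => //; split => /=.
  - by move: Fkx; exact/subsetPset/ndF/leq_maxl.
  - by move: Glv; exact/subsetPset/ndG/leq_maxr.
move=> k; have [mF Fk] := Foo k; have [mG Gk] := Goo k; split.
  by rewrite -[X in measurable X]setTI; apply: measurable_uncons_rV => //;
    exact: measurableX.
rewrite /cons_measure /pushforward -comp_preimage.
rewrite (_ : _ \o _ = id); last by apply/funext => xv; exact: cons_rVK.
by rewrite preimage_id product_measure1E// lte_mul_pinfty// ge0_fin_numE.
Qed.

HB.instance Definition _ := @Measure_isSigmaFinite.Build _ _ _
  cons_measure sigma_finite_cons.

End pushforward_cons.

Fixpoint lebesgue_rV n : {sigma_finite_measure set 'rV[R]_n -> \bar R} :=
  if n is m.+1 then cons_measure (lebesgue_rV m) else \d_(0 : 'rV[R]_0).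

Lemma measurable_box_rV n (A : 'I_n -> set R) : (forall i, measurable (A i)) ->
  measurable [set v : 'rV[R]_n | forall i, A i (v 0 i)].
Proof.
move=> mA; rewrite [X in measurable X](_ : _ =
    \bigcap_(i in [set: 'I_n]) ((fun v : 'rV[R]_n => v 0 i) @^-1` A i)); last first.
  by apply/seteqP; split=> v /= Av i; [move=> _; exact: Av|exact: (Av i I)].
apply: fin_bigcap_measurable => // i _; rewrite -[X in measurable X]setTI.
have : measurable_fun setT (fun v : 'rV[R]_n => v 0 i); last exact.
by apply: continuous_measurable_rV => v; exact: coord_continuous.
Qed.

Lemma lebesgue_rV_box n (A : 'I_n -> set R) : (forall i, measurable (A i)) ->
  lebesgue_rV n [set v | forall i, A i (v 0 i)] =
  (\prod_(i < n) @lebesgue_measure R (A i))%E.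
Proof.
elim: n A => [|n IH] A mA.
  by rewrite big_ord0 /= diracE mem_set// => -[].
rewrite big_ord_recl -IH// /= /cons_measure /pushforward.
pose B := [set v : 'rV[R]_n | forall i, A (lift ord0 i) (v 0 i)].
transitivity ((@lebesgue_measure R \x lebesgue_rV n)%E (A ord0 `*` B)); last first.
  apply: product_measure1E; first exact: mA.
  by apply: (@measurable_box_rV _ (fun i => A (lift ord0 i))) => i; exact: mA.
congr (_ _); apply/seteqP; split=> [[x v] Axv|[x v] [/= Ax Av] i].
  split=> [|i] /=.
    by have := Axv 0; rewrite mxE; case: split_ordP => k //= _; rewrite mxE.
  have := Axv (lift ord0 i); rewrite mxE; case: split_ordP => k //= ik.
    by move/(congr1 val): ik; rewrite /= ord1.
  by have -> : k = i by apply/val_inj; move/(congr1 val): ik => /= -[].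
rewrite mxE; case: split_ordP => k ->; first last.
  by have -> : rshift 1 k = lift ord0 k by exact/val_inj.
by rewrite mxE (_ : lshift n k = 0)//; apply/val_inj; rewrite /= ord1.
Qed.

End lebesgue_rV.

Section Lspace_metric.
Context d (T : measurableType d) (R : realType).
Variables (mu : {measure set T -> \bar R}) (p : \bar R) (p1 : (1 <= p)%E).
Implicit Types f g h : LspaceType mu p1.

Definition Lspace_dist f g : R := fine ('N[mu]_p[EFin \o ((f : T -> R) \- (g : T -> R))%R])%E.

Let Lspace_Lfun f : (f : T -> R) \in Lfun mu p.
Proof.
have mf := @measurable_funPT _ _ _ _ (repr (LebesgueSpace.sort f)).
rewrite inE; apply/andP; split; rewrite inE/=.
  by move=> mT Y mY; exact: mf.
exact: Lebesgue_finite.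
Qed.

Let toL f : LfunType mu p1 := Lfun_Sub p1 (Lspace_Lfun f).

Let Lspace_distE f g :
  Lspace_dist f g = fine ('N[mu]_p[EFin \o (toL f - toL g)%R])%E.
Proof. by []. Qed.

Lemma Lspace_distxx f : Lspace_dist f f = 0.
Proof. by rewrite Lspace_distE subrr/= Lnorm0// gt_eqF// (lt_le_trans _ p1). Qed.

Lemma Lspace_dist_positivity f g : Lspace_dist f g = 0 -> f = g.
Proof.
rewrite Lspace_distE => /fine_Lnormr_eq0 fg0.
have fgE : LebesgueSpace.sort f = LebesgueSpace.sort g.
  rewrite -[LHS]reprK -[RHS]reprK; apply/eqmodP/asboolP.
  apply: filterS fg0 => x /= + xT => /(_ xT) /eqP.
  by rewrite subr_eq0 => /eqP.
case: f g fgE {fg0} => [f [[ff]]] [g [[gg]]] /= fgE.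
by subst g; rewrite (Prop_irrelevance ff gg).
Qed.

Lemma Lspace_dist_sym f g : Lspace_dist f g = Lspace_dist g f.
Proof. by rewrite !Lspace_distE -[in RHS]LnormrN -opprB. Qed.

Lemma Lspace_dist_triangle f g h :
  Lspace_dist g h <= Lspace_dist g f + Lspace_dist f h.
Proof. by rewrite !Lspace_distE (le_trans _ (ler_LnormD _ _))// addrA subrK. Qed.

HB.instance Definition _ := gen_eqMixin (LspaceType mu p1).
HB.instance Definition _ := gen_choiceMixin (LspaceType mu p1).

HB.instance Definition _ := @isMetric.Build R (LspaceType mu p1)
  Lspace_dist Lspace_distxx Lspace_dist_positivity Lspace_dist_sym
  Lspace_dist_triangle.

End Lspace_metric.

Section bv_on_domain.
Context (R : realType) (d : nat).
Implicit Types (Omega : set 'rV[R]_d) (u : 'rV[R]_d -> R).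

Definition lebesgue_on Omega (oOmega : open Omega) :
    {measure set 'rV[R]_d -> \bar R} :=
  mrestr (lebesgue_rV R d) (open_measurable_rV oOmega).

(* The elements of L2 are a.e.-equivalence classes; the coercion to functions
   picks a representative, on which the notions below do not depend. *)
Definition L2 Omega (oOmega : open Omega) := LspaceType2 (lebesgue_on oOmega).

(* The library norm on 'rV[R]_d is the maximum norm. *)
Definition enorm (v : 'rV[R]_d) : R := Num.sqrt (\sum_(i < d) v 0 i ^+ 2).

(* A field in C^1_c(Omega)^d is identified with its extension by 0. *)
Definition C1c Omega (phi : 'rV[R]_d -> 'rV[R]_d) : Prop :=
  [/\ forall x, differentiable phi x,
      forall v, continuous ('D_v phi),
      compact (closure [set x | phi x != 0]) &
      closure [set x | phi x != 0] `<=` Omega].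

Definition divergence (phi : 'rV[R]_d -> 'rV[R]_d) (x : 'rV[R]_d) : R :=
  \sum_(i < d) 'D_(delta_mx 0 i) (fun y => phi y 0 i) x.

Definition tv_fields Omega : set ('rV[R]_d -> 'rV[R]_d) :=
  [set phi | C1c Omega phi /\ forall s, Omega s -> enorm (phi s) <= 1].

Definition tv Omega u : \bar R :=
  ereal_sup [set (\int[lebesgue_rV R d]_(x in Omega)
                    (u x * divergence phi x)%:E)%E | phi in tv_fields Omega].

Definition bv Omega (oOmega : open Omega) u : Prop :=
  u \in Lfun (lebesgue_on oOmega) 1%E /\ (tv Omega u < +oo)%E.

(* Around each boundary point, up to a rotation or reflection Q and the choice
   k of the vertical axis, Omega is the strict epigraph of a Lipschitz function
   of the d - 1 other coordinates. Bounded open sets of this kind are extension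
   domains (for W^{1,p} and BV). *)
Definition lipschitz_boundary Omega : Prop :=
  forall p, (closure Omega `\` Omega°) p ->
  exists (Q : 'M[R]_d) (k : 'I_d) (gamma : 'rV[R]_d.-1 -> R) (L r : R),
    [/\ Q *m Q^T = 1%:M, L.-lipschitz gamma, 0 < r &
        forall x, ball p r x ->
          Omega x <-> gamma (col' k (x *m Q)) < (x *m Q) 0 k].

Definition feasible Omega (M : nat) (nu : 'I_M -> int) u : Prop :=
  {ae lebesgue_rV R d, forall x, Omega x -> exists i, u x = (nu i)%:~R}.

End bv_on_domain.

(* Main.v *)
(* A function with values in {nu_i} is bounded, so no extension of BV functions across the boundary is
   needed: L^1-compactness follows from an interior estimate and the smallness of a boundary layer.
   For the interior, compare a fine quadratic B-spline partition of unity (mesh h = H / m) with a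
   coarse one (mesh H): the difference of a fine tensor-product spline and the corresponding multiple
   of the coarse spline of its cell is the divergence of a C^1_c field, obtained by replacing the
   fine factors by coarse ones coordinate by coordinate and integrating the difference in the
   coordinate that changes. Summing over the cells inside an open set U gives a field of size O(H),
   so the integral of u over U is bounded by O(H) TV(u) plus integrals of u against the finitely many
   coarse splines, uniformly in U as h -> 0. By outer regularity the same holds for U = {u > 0} and
   U = {u < 0}, which bounds the L^1 norm. The coarse integrals converge along an ultrafilter, so a
   minimizing sequence has a subsequence with summable L^1 increments; its terms being
   integer-valued, it is almost everywhere eventually constant. The limit is a minimizer by lower
   semicontinuity of F and of TV. *)
Require Import Defs.
From HB Require Import structures.
From mathcomp Require Import all_boot all_order all_algebra.
From mathcomp Require Import all_classical all_reals all_analysis.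
From mathcomp Require Import measurable_realfun ring lra.
Import Order.TTheory GRing.Theory Num.Theory.
Import numFieldNormedType.Exports.
Local Open Scope classical_set_scope.
Local Open Scope ring_scope.

Set Implicit Arguments.
Unset Strict Implicit.
Unset Printing Implicit Defensive.

(** * Outer regularity of finite measures *)

(** The estimate has to hold for every open set [U] at once, however irregular its boundary. The
    size of the field is therefore read off one-dimensional sums of nonnegative families, each sum
    at most 1: neither [U] nor the refinement [m] enters. The coordinate that changes contributes
    O(H), because each of the [m] primitives attached to a coarse cell is O(h) and m * h = H. The
    multiple of the coarse spline is the one with the mass of the fine spline, so the primitive of
    their difference vanishes beyond both supports; this keeps the field compactly supported. A
    selected cell needs its coarse box in [Omega] but only its fine box in [U]: coarse splines may
    leave [U], and the part of [U] that is missed shrinks with h. Quadratic splines have the least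
    degree for which the field is C^1. The mesh H is fixed by the boundary layer of [Omega] and the
    bound on TV alone, so finitely many coarse splines serve all [U]. *)

Section inner_core.
Context (R : realType) (n : nat).
Implicit Types (U A : set 'rV[R]_n) (r : R).

(** Erosion of [U]. Balls are cubes of the maximum norm, so a point of the core sees every box of
    side less than [r] through it stay inside [U]. *)
Definition core U r := [set x | ball x r `<=` U].

Lemma core_closed U r : closed (core U r).
Proof.
rewrite -openC (_ : ~` _ = \bigcup_(y in ~` U) ball y r).
  by apply: bigcup_open => y _; exact: ball_open.
apply/seteqP; split => [x /existsNP[y /not_implyP[xy Uy]]|x [y Uy yx] xU].
  by exists y => //; exact: ball_sym.
by apply: Uy; apply: xU; exact: ball_sym.
Qed.

Lemma core_measurable U r : measurable (core U r).
Proof.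
rewrite -[core U r]setCK; apply: measurableC; apply: open_measurable_rV.
by apply: closed_openC; exact: core_closed.
Qed.

Lemma sub_core U r : 0 < r -> core U r `<=` U.
Proof. by move=> r0 x; apply; exact: ballxx. Qed.

Lemma le_core U r s : r <= s -> core U s `<=` core U r.
Proof. by move=> rs x xU y xy; apply: xU; exact: le_ball xy. Qed.

Lemma mu_cvg0_lt (mu : {measure set 'rV[R]_n -> \bar R}) (F : (set 'rV[R]_n)^nat) (e : R) :
  (mu (F 0%N) < +oo)%E -> (forall i, measurable (F i)) -> nonincreasing_seq F ->
  \bigcap_i F i = set0 -> 0 < e -> exists N, (mu (F N) < e%:E)%E.
Proof.
move=> F0 mF dF capF e0.
have : mu \o F @ \oo --> mu (\bigcap_i F i).
  by apply: nonincreasing_cvg_mu => //; rewrite capF; exact: measurable0.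
rewrite capF measure0 => /(_ [set y | (y < e%:E)%E]) [|N _ /(_ N)]/=.
  by apply: open_nbhs_nbhs; split; [exact: open_ereal_lt_ereal|rewrite /= lte_fin].
by move=> /(_ (leqnn N)); exists N.
Qed.

(** [U] is open, so the layers between [U] and its cores decrease to the empty set, and continuity
    from above applies. All smaller radii are included because [r] is compared later with a mesh
    size. *)
Lemma core_exhaust (mu : {measure set 'rV[R]_n -> \bar R}) U (e : R) :
  (mu U < +oo)%E -> open U -> 0 < e ->
  exists2 r, 0 < r & forall s, 0 < s -> s <= r -> (mu (U `\` core U s) < e%:E)%E.
Proof.
move=> Uoo oU e0; have mU := open_measurable_rV oU.
have mUc s : measurable (U `\` core U s).
  by apply: measurableD => //; exact: core_measurable.
have [N Ne] : exists N, (mu (U `\` core U N.+1%:R^-1) < e%:E)%E.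
  apply: (@mu_cvg0_lt mu (fun k => U `\` core U k.+1%:R^-1) e) => //.
  - by apply: le_lt_trans Uoo; rewrite le_measure ?inE//; exact: subDsetl.
  - move=> i j ij; apply/subsetPset => x [Ux xj]; split => // xi; apply: xj.
    by apply: le_core xi; rewrite lef_pV2 ?posrE// ler_nat.
  - apply/seteqP; split => // x xU.
    have Ux : U x by have [] := xU 0%N I.
    have /nbhs_ballP[r /= r0 rU] : nbhs x U by exact: open_nbhs_nbhs.
    have [] := xU (Num.trunc r^-1) I; move=> _; apply => y xy; apply: rU.
    apply: le_ball xy; apply: ltW.
    by rewrite invf_plt ?posrE// Num.Theory.truncnS_gt.
exists N.+1%:R^-1 => [|s s0 sN]; first by rewrite invr_gt0.
apply: le_lt_trans Ne; rewrite le_measure ?inE//.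
by apply: setDS; exact: le_core.
Qed.

(** Two-sided approximation: complementation exchanges the closed and the open set, whereas
    approximation from outside alone would not pass to complements. *)
Let approx (mu : set 'rV[R]_n -> \bar R) A := forall e : R, 0 < e ->
  exists K U, [/\ closed K, open U, K `<=` A, A `<=` U & (mu (U `\` K) < e%:E)%E].

(** The sets with two-sided approximation form a sigma-algebra, and open sets belong to it because
    their cores approximate them from inside. *)
Lemma finite_measure_regular (mu : {finite_measure set 'rV[R]_n -> \bar R}) A (e : R) :
  measurable A -> 0 < e -> exists U, [/\ open U, A `<=` U & (mu (U `\` A) < e%:E)%E].
Proof.
move=> mA e0; have muoo B : measurable B -> (mu B < +oo)%E.
  by move=> mB; rewrite ltey_eq fin_num_measure.
have mC (B : set 'rV[R]_n) : closed B -> measurable B.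
  move=> cB; rewrite -[B]setCK; apply: measurableC; apply: open_measurable_rV.
  exact: closed_openC.
suff : approx mu A.
  move=> /(_ _ e0)[K [U [cK oU KA AU UK]]]; exists U; split => //.
  apply: le_lt_trans UK; rewrite le_measure ?inE//; last exact: setDS.
  - by apply: measurableD => //; exact: open_measurable_rV.
  - by apply: measurableD; [exact: open_measurable_rV|exact: mC].
have : <<s open >> A by exact: mA.
apply: smallest_sub; last first.
  move=> U oU {}e {}e0; have mU := open_measurable_rV oU.
  have [r r0 /(_ r r0 (lexx _)) rU] := core_exhaust (muoo _ mU) oU e0.
  by exists (core U r), U; split => //; [exact: core_closed|exact: sub_core].
split.
- move=> {}e {}e0; exists set0, set0; split => //.
    exact: closed0.
  by rewrite setD0 measure0.
- move=> B aB {}e {}e0; have [K [U [cK oU KB BU UK]]] := aB e e0.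
  exists (~` U), (~` K); split; [exact: open_closedC|exact: closed_openC| | |].
  + by rewrite setTD; exact: subsetC.
  + by rewrite setTD; exact: subsetC.
  + by rewrite setDE setCK setIC -setDE.
- move=> B aB {}e {}e0.
  have : forall i, exists KU : set 'rV[R]_n * set 'rV[R]_n,
      [/\ closed KU.1, open KU.2, KU.1 `<=` B i, B i `<=` KU.2 &
        (mu (KU.2 `\` KU.1) < (e / 2 / (2 ^ i.+1)%:R)%:E)%E].
    move=> i; have [|K [U KU]] := aB i (e / 2 / (2 ^ i.+1)%:R).
      by rewrite !divr_gt0// ltr0n expn_gt0.
    by exists (K, U).
  move=> /choice[KU KUP].
  pose K i := (KU i).1; pose U i := (KU i).2.
  have cK i : closed (K i) by have [] := KUP i.
  have oU i : open (U i) by have [] := KUP i.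
  have mU := open_measurable_rV (oU _).
  have mK i := mC _ (cK i).
  (* An infinite union of closed sets need not be closed, so only the first [N] inner sets are kept.
     Half of [e] pays for the others, half for the gaps between [U i] and [K i]. *)
  pose G N := (\bigcup_i K i) `\` \bigcup_(i < N) K i.
  have mG N : measurable (G N).
    by apply: measurableD; apply: bigcup_measurable => i _.
  have [N GN] : exists N, (mu (G N) < (e / 2)%:E)%E.
    apply: mu_cvg0_lt => //.
    + exact: muoo.
    + move=> i j ij; apply/subsetPset; apply: setDS => x [k /= ki Kx].
      by exists k => //=; exact: leq_trans ij.
    + apply/seteqP; split => // x xG; have [[k _ Kx] _] := xG 0%N I.
      by have [_] := xG k.+1 I; apply; exists k => /=.
    + by rewrite divr_gt0.
  exists (\bigcup_(i < N) K i), (\bigcup_i U i); split.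
  + by apply: closed_bigcup => //; exact: finite_II.
  + by apply: bigcup_open.
  + move=> x [k _ Kx]; exists k => //; have [_ _ + _ _] := KUP k; exact.
  + move=> x [k _ Bx]; exists k => //; have [_ _ _ + _] := KUP k; exact.
  have mUK i : measurable (U i `\` K i) by apply: measurableD.
  apply: (@le_lt_trans _ _ (mu (G N `|` \bigcup_i (U i `\` K i)))).
    rewrite le_measure ?inE//.
    * apply: measurableD; first exact: bigcup_measurable.
      by apply: bigcup_measurable.
    * by apply: measurableU => //; exact: bigcup_measurable.
    * move=> x [[k _ Ux] xK].
      have [Kx|Kx] := pselect (K k x); last by right; exists k.
      by left; split => //; exists k.
  apply: le_lt_trans (measureU2 _ _ _) _ => //; first exact: bigcup_measurable.
  rewrite [e]splitr EFinD lte_leD//.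
    by rewrite ge0_fin_numE// muoo//; exact: bigcup_measurable.
  apply: (@le_trans _ _ (\sum_(0 <= i <oo) mu (U i `\` K i))%E).
    by apply: measure_sigma_subadditive => //; exact: bigcup_measurable.
  apply: (le_trans _ (@epsilon_trick0 R (e / 2) xpredT _)); last by rewrite divr_ge0// ltW.
  by apply: lee_nneseries => // i _; have [_ _ _ _ /ltW] := KUP i.
Qed.

End inner_core.

(** * Functions of class C^1 *)

Section C1_functions.
Context (R : realType) (V : normedModType R).

Definition C1 (W : normedModType R) (f : V -> W) :=
  (forall x, differentiable f x) /\ (forall v, continuous ('D_v f)).

Lemma C1_continuous (W : normedModType R) (f : V -> W) : C1 f -> continuous f.
Proof. by move=> [df _] x; exact: differentiable_continuous. Qed.

Lemma C1_derivable (W : normedModType R) (f : V -> W) x v :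
  C1 f -> derivable f x v.
Proof. by move=> [df _]; exact: diff_derivable. Qed.

Lemma C1_cst (W : normedModType R) (c : W) : C1 (cst c : V -> W).
Proof.
split=> [x|v]; first exact: differentiable_cst.
rewrite (_ : 'D_v _ = cst 0) => [x|]; first exact: cst_continuous.
by apply/funext => x; rewrite derive_cst.
Qed.

Lemma C1D (W : normedModType R) (f g : V -> W) : C1 f -> C1 g -> C1 (fun x => f x + g x).
Proof.
move=> f1 g1; split=> [x|v].
  by apply: differentiableD; [exact: f1.1|exact: g1.1].
rewrite (_ : 'D_v _ = (fun x => 'D_v f x + 'D_v g x)) => [x|].
  by apply: cvgD; [exact: f1.2|exact: g1.2].
by apply/funext => x; rewrite -deriveD//; exact: C1_derivable.
Qed.

Lemma C1M (f g : V -> R) : C1 f -> C1 g -> C1 (fun x => f x * g x).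
Proof.
move=> f1 g1; split=> [x|v].
  by apply: differentiableM; [exact: f1.1|exact: g1.1].
rewrite (_ : 'D_v _ = (fun x => f x * 'D_v g x + g x * 'D_v f x)) => [x|].
  by apply: cvgD; apply: cvgM;
    [exact: C1_continuous|exact: g1.2|exact: C1_continuous|exact: f1.2].
by apply/funext => x; rewrite (@deriveM _ _ f g)//; exact: C1_derivable.
Qed.

Lemma derive_scalel (W : normedModType R) (f : V -> R) (c : W) x v :
  C1 f -> 'D_v (fun y => f y *: c) x = 'D_v f x *: c.
Proof.
move=> f1; rewrite !deriveE; [|exact: f1.1|apply: differentiableZl; exact: f1.1].
by rewrite diffZl//; exact: f1.1.
Qed.

Lemma C1Z (W : normedModType R) (f : V -> R) (c : W) : C1 f -> C1 (fun x => f x *: c).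
Proof.
move=> f1; split=> [x|v]; first by apply: differentiableZl; exact: f1.1.
rewrite (_ : 'D_v _ = (fun x => 'D_v f x *: c)) => [x|].
  by apply: cvgZl; exact: f1.2.
by apply/funext => x; rewrite derive_scalel.
Qed.

Lemma C1_sum (W : normedModType R) I (r : seq I) (P : pred I) (f : I -> V -> W) :
  (forall i, C1 (f i)) -> C1 (fun x => \sum_(i <- r | P i) f i x).
Proof.
move=> f1; elim: r => [|i r IH].
  by under eq_fun do rewrite big_nil; exact: C1_cst.
under eq_fun do rewrite big_cons.
by case: (P i) => //; exact: C1D.
Qed.

Lemma derive_sum_seq (W : normedModType R) I (r : seq I) (P : pred I) (f : I -> V -> W) x v :
  (forall i, C1 (f i)) ->
  'D_v (fun x => \sum_(i <- r | P i) f i x) x = \sum_(i <- r | P i) 'D_v (f i) x.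
Proof.
move=> f1; elim: r => [|i r IH].
  by under eq_fun do rewrite big_nil; rewrite big_nil derive_cst.
under eq_fun do rewrite big_cons; rewrite big_cons.
case: (P i) => //; rewrite -IH -deriveD//; first exact: C1_derivable.
by apply: C1_derivable; exact: C1_sum.
Qed.

Lemma C1_prod I (r : seq I) (P : pred I) (f : I -> V -> R) :
  (forall i, C1 (f i)) -> C1 (fun x => \prod_(i <- r | P i) f i x).
Proof.
move=> f1; elim: r => [|i r IH].
  by under eq_fun do rewrite big_nil; exact: C1_cst.
under eq_fun do rewrite big_cons.
by case: (P i) => //; exact: C1M.
Qed.

End C1_functions.

Section C1_coordinates.
Context (R : realType) (d : nat).
Implicit Types (g : R -> R) (i j : 'I_d).

Lemma derive_coord g i (x v : 'rV[R]_d) : (forall t, derivable g t 1) ->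
  'D_v (fun y : 'rV[R]_d => g (y 0 i)) x = v 0 i * derive1 g (x 0 i).
Proof.
move=> dg.
have dc : differentiable (fun y : 'rV[R]_d => y 0 i) x.
  exact: differentiable_coord.
have dgx : differentiable g (x 0 i) by apply/derivable1_diffP.
rewrite deriveE; last exact: (differentiable_comp dc dgx).
rewrite (diff_comp dc dgx) /= deriv1E//; congr (_ * _).
rewrite -deriveE//; have := derive_mx (@derivable_id _ _ x v).
by rewrite derive_id => /matrixP/(_ 0 i) ->; rewrite mxE.
Qed.

Lemma C1_coord g i : (forall t, derivable g t 1) -> continuous (derive1 g) ->
  C1 (fun y : 'rV[R]_d => g (y 0 i)).
Proof.
move=> dg cg; split=> [x|v].
  apply: (@differentiable_comp _ _ _ _ (fun y : 'rV[R]_d => y 0 i) g).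
    exact: differentiable_coord.
  exact/derivable1_diffP.
rewrite (_ : 'D_v _ = (fun x : 'rV[R]_d => v 0 i * derive1 g (x 0 i))) => [x|].
  apply: (@cvgM _ _ (nbhs x) _ (fun=> v 0 i) (fun x : 'rV[R]_d => derive1 g (x 0 i))).
    exact: cvg_cst.
  by apply: (@continuous_comp _ _ _ (fun y : 'rV[R]_d => y 0 i) (derive1 g)); [exact: coord_continuous|exact: cg].
by apply/funext => x; exact: derive_coord.
Qed.

End C1_coordinates.

(** * Quadratic B-splines *)

Section spline.
Context (R : realType).
Implicit Types t : R.

Definition pos_part t : R := Num.max t 0.

Lemma pos_part_continuous : continuous pos_part.
Proof.
move=> t; apply: (@continuous_max _ _ (@id R) (cst 0)); first exact: cvg_id.
exact: cst_continuous.
Qed.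

(** The kink at 0 is harmless: the first-order remainder is at most h^2 wherever t and t + h lie, by
    cases on their signs. *)
Lemma is_derive_pos_part2 t : is_derive t 1 (fun s => pos_part s ^+ 2) (2 * pos_part t).
Proof.
have H h : `|pos_part (t + h) ^+ 2 - pos_part t ^+ 2 - 2 * pos_part t * h| <= h ^+ 2.
  by rewrite ler_norml /pos_part /Num.max; case: ltP => ?; case: ltP => ?; nra.
suff cvgD : h^-1 *: (pos_part (h *: 1 + t) ^+ 2 - pos_part t ^+ 2) @[h --> 0^'] -->
    (2 * pos_part t : R).
  by apply: DeriveDef; [apply/cvg_ex; exists (2 * pos_part t)|exact/cvg_lim].
apply/cvgrPdist_le => e e0; near=> h.
have h0 : h != 0 by near: h; exact: nbhs_dnbhs_neq.
rewrite distrC -(@ler_pM2r _ `|h|) ?normr_gt0// -normrM.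
rewrite /GRing.scale/= mulrBl mulrAC mulVf// mul1r mulr1 addrC.
apply: (@le_trans _ _ (h ^+ 2)).
  apply: le_trans (H h); rewrite [t + h]addrC le_eqVlt; apply/orP; left.
  by apply/eqP; congr `|_|; ring.
rewrite -(ger0_norm (sqr_ge0 h)) expr2 normrM ler_wpM2r//.
near: h; apply: dnbhs0_le; exact: e0.
Unshelve. all: by end_near. Qed.

Lemma is_derive_pos_part3 t : is_derive t 1 (fun s => pos_part s ^+ 3) (3 * pos_part t ^+ 2).
Proof.
rewrite (_ : (fun s => _) = (fun s => s * pos_part s ^+ 2)); last first.
  by apply/funext => s; rewrite /pos_part /Num.max; case: ltP => ?; ring.
have D2 := is_derive_pos_part2 t.
apply: is_derive_eq.
rewrite /GRing.scale/= /pos_part /Num.max; case: ltP => ?; ring.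
Qed.

(* The sums of consecutive integer translates of [bump] telescope to differences of [step]. *)
Definition step t : R :=
  (pos_part t ^+ 2 - 2 * pos_part (t - 1) ^+ 2 + pos_part (t - 2) ^+ 2) / 2.
(** The cardinal quadratic B-spline, supported in [0, 3]: [step] is a primitive of the hat function
    on [0, 2], and the difference of two translates averages that hat over a unit interval. *)
Definition bump t : R := step t - step (t - 1).
Definition Step t : R :=
  (pos_part t ^+ 3 - 2 * pos_part (t - 1) ^+ 3 + pos_part (t - 2) ^+ 3) / 6.
(** The primitive of [bump] that vanishes on the left; it ends at 1, the mass of [bump]. *)
Definition Bump t : R := Step t - Step (t - 1).

Lemma step_le0 t : t <= 0 -> step t = 0.
Proof.
by move=> t0; rewrite /step /pos_part !max_r; [ring|lra..].
Qed.

Lemma step_ge2 t : 2 <= t -> step t = 1.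
Proof.
by move=> t0; rewrite /step /pos_part !max_l; [field|lra..].
Qed.

Lemma step_bounds t : 0 <= step t <= 1.
Proof.
rewrite /step /pos_part /Num.max; case: ltP => ?; case: ltP => ?; case: ltP => ?; nra.
Qed.

Lemma bump_ge0 t : 0 <= bump t.
Proof.
rewrite /bump /step (_ : t - 1 - 1 = t - 2); last by ring.
rewrite (_ : t - 1 - 2 = t - 3); last by ring.
rewrite /pos_part /Num.max; do 4 (case: ltP => ?); nra.
Qed.

Lemma bump_eq0 t : (t <= 0) || (3 <= t) -> bump t = 0.
Proof.
move=> /orP[t0|t3]; rewrite /bump; first by rewrite !step_le0 ?subr0//; lra.
by rewrite !step_ge2 ?subrr//; lra.
Qed.

Lemma Bump_le0 t : t <= 0 -> Bump t = 0.
Proof.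
by move=> t0; rewrite /Bump /Step /pos_part !max_r; [ring|lra..].
Qed.

Lemma Bump_ge3 t : 3 <= t -> Bump t = 1.
Proof.
by move=> t0; rewrite /Bump /Step /pos_part !max_l; [field|lra..].
Qed.

(** A crude bound is enough. In the sum of truncated cubes the positive coefficients add up to 4
    before the division by 6, and so do the negative ones in absolute value; each cube is at most
    27, and 18 = 4 * 27 / 6. *)
Lemma Bump_bound t : 0 <= t <= 3 -> `|Bump t| <= 18.
Proof.
have H s : s <= 3 -> 0 <= pos_part s ^+ 3 <= 27.
  by move=> s3; rewrite /pos_part /Num.max; case: ltP => ?; rewrite ?expr0n /= ?lexx /=; nra.
move=> /andP[t0 t3]; rewrite ler_norml /Bump /Step.
have := H t t3; have /H : t - 1 <= 3 by lra.
have /H : t - 2 <= 3 by lra.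
have /H : t - 1 - 1 <= 3 by lra.
have /H : t - 1 - 2 <= 3 by lra.
by move=> /andP[? ?] /andP[? ?] /andP[? ?] /andP[? ?] /andP[? ?]; apply/andP; split; lra.
Qed.

Lemma is_derive_shiftl (f f' : R -> R) (c t : R) : (forall s : R, is_derive s 1 f (f' s)) ->
  is_derive t 1 (fun s => f (s - c)) (f' (t - c)).
Proof.
move=> Df; have Dg : is_derive t 1 (fun s => s - c) (1 : R).
  by apply: is_derive_eq; rewrite subr0.
by rewrite -[f' _]mulr1; exact: (is_derive1_comp (g := fun s => s - c)).
Qed.

Lemma is_derive_Step t : is_derive t 1 Step (step t).
Proof.
have D0 := is_derive_pos_part3 t.
have D1 := is_derive_shiftl 1 t is_derive_pos_part3.
have D2 := is_derive_shiftl 2 t is_derive_pos_part3.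
rewrite /Step; apply: is_derive_eq; rewrite /step /GRing.scale/=; by field.
Qed.

Lemma is_derive_step t : is_derive t 1 step
  (pos_part t - 2 * pos_part (t - 1) + pos_part (t - 2)).
Proof.
have D0 := is_derive_pos_part2 t.
have D1 := is_derive_shiftl 1 t is_derive_pos_part2.
have D2 := is_derive_shiftl 2 t is_derive_pos_part2.
rewrite /step; apply: is_derive_eq; rewrite /GRing.scale/=; by field.
Qed.

Lemma is_derive_Bump t : is_derive t 1 Bump (bump t).
Proof.
have D0 := is_derive_Step t; have D1 := is_derive_shiftl 1 t is_derive_Step.
exact: is_deriveB.
Qed.

Lemma bump_derivable t : derivable bump t 1.
Proof.
have D0 := is_derive_step t; have D1 := is_derive_shiftl 1 t is_derive_step.
by have [] := is_deriveB D0 D1.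
Qed.

Lemma bump_continuous_derive : continuous (derive1 bump).
Proof.
have pc c : continuous (fun t => pos_part (t - c)).
  move=> t; apply: (@continuous_comp _ _ _ (fun s : R => s - c) pos_part).
    by apply: cvgB; [exact: cvg_id|exact: cvg_cst].
  exact: pos_part_continuous.
rewrite (_ : derive1 bump = (fun t => pos_part (t - 0) - 2 * pos_part (t - 1) + pos_part (t - 2) -
    (pos_part (t - 1) - 2 * pos_part (t - 2) + pos_part (t - 3)))) => [t|].
  apply: cvgB; (apply: cvgD; last exact: pc); apply: cvgB; try exact: pc;
    by apply: cvgM; [exact: cvg_cst|exact: pc].
apply/funext => t; rewrite derive1E.
have D0 := is_derive_step t; have D1 := is_derive_shiftl 1 t is_derive_step.
have [_ ->] := is_deriveB D0 D1.
have E2 : t - 1 - 1 = t - 2 by ring.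
have E3 : t - 1 - 2 = t - 3 by ring.
by rewrite E2 E3 subr0.
Qed.

End spline.

(** * Transport fields between two families of tensor products *)

Section product_derivatives.
Context (R : realType).

Lemma derive_prod0 (V : normedModType R) I (r : seq I) (P : pred I) (f : I -> V -> R) x v :
  (forall i, C1 (f i)) -> (forall i, P i -> 'D_v (f i) x = 0) ->
  'D_v (fun y => \prod_(i <- r | P i) f i y) x = 0.
Proof.
move=> f1 f0; elim: r => [|i r IH].
  by under eq_fun do rewrite big_nil; rewrite derive_cst.
under eq_fun do rewrite big_cons.
case: (P i) (f0 i) => // /(_ isT) fi0.
have fr := C1_prod r P f1.
rewrite (@deriveM _ _ (f i) (fun y => \prod_(i <- r | P i) f i y)).
- by rewrite IH fi0 !scaler0 addr0.
- exact: C1_derivable.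
- exact: C1_derivable.
Qed.

Context (d : nat).

Lemma derive_prod_coord (f : 'I_d -> R -> R) (i : 'I_d) (x : 'rV[R]_d) :
  (forall j t, derivable (f j) t 1) -> (forall j, continuous (derive1 (f j))) ->
  'D_(delta_mx 0 i) (fun y : 'rV[R]_d => \prod_j f j (y 0 j)) x =
  derive1 (f i) (x 0 i) * \prod_(j | j != i) f j (x 0 j).
Proof.
move=> df cf.
have f1 j : C1 (fun y : 'rV[R]_d => f j (y 0 j)) by exact: C1_coord.
under eq_fun do rewrite (bigD1 i)//=.
have fr := C1_prod (index_enum 'I_d) (fun j => j != i) f1.
rewrite (@deriveM _ _ (fun y : 'rV[R]_d => f i (y 0 i))
  (fun y : 'rV[R]_d => \prod_(j | j != i) f j (y 0 j))); [|exact: C1_derivable..].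
rewrite [X in _ *: X + _]derive_prod0//; last first.
  by move=> j ji; rewrite derive_coord// mxE (negbTE ji) andbF mul0r.
by rewrite scaler0 add0r derive_coord// mxE !eqxx mul1r /GRing.scale/= mulrC.
Qed.

Lemma enorm_le_sum (v : 'rV[R]_d) : enorm v <= \sum_i `|v 0 i|.
Proof.
have S0 : 0 <= \sum_i `|v 0 i| by exact: sumr_ge0.
rewrite /enorm -[leRHS](ger0_norm S0) -sqrtr_sqr ler_sqrt ?sqr_ge0//.
rewrite expr2 mulr_suml; apply: ler_sum => i _.
rewrite -real_normK ?num_real// expr2 ler_wpM2l//.
by rewrite (bigD1 i)//= lerDl; exact: sumr_ge0.
Qed.

End product_derivatives.

Section test_field.
Context (R : realType) (d : nat) (J : finType).
Variables (eta beta Phi : J -> R -> R) (lo hi : J -> R) (K : R).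
Hypotheses (eta_derivable : forall a t, derivable (eta a) t 1)
  (eta_derive : forall a, continuous (derive1 (eta a)))
  (beta_derivable : forall a t, derivable (beta a) t 1)
  (beta_derive : forall a, continuous (derive1 (beta a)))
  (Phi_derive : forall a (t : R), is_derive t 1 (Phi a) (eta a t - beta a t)).
Hypotheses (eta_ge0 : forall a t, 0 <= eta a t) (eta_le1 : forall t, \sum_a eta a t <= 1)
  (beta_ge0 : forall a t, 0 <= beta a t) (beta_le1 : forall t, \sum_a beta a t <= 1)
  (Phi_le : forall t, \sum_a `|Phi a t| <= K).
Hypothesis supp : forall a t, ~~ (lo a <= t <= hi a) ->
  [/\ eta a t = 0, beta a t = 0 & Phi a t = 0].
Implicit Types (q : {ffun 'I_d -> J}) (A : pred {ffun 'I_d -> J}) (x : 'rV[R]_d).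

Definition cell_box q : set 'rV[R]_d := [set x | forall i, lo (q i) <= x 0 i <= hi (q i)].

(** Factors of the component [i]: coordinates below [i] already carry [beta], those above still
    carry [eta]. The linear order of the coordinates is what lets the divergence telescope. *)
Definition hybrid (i j : 'I_d) (a : J) : R -> R :=
  if (j < i)%N then beta a else if j == i then Phi a else eta a.

Definition hybrid_sum A i x := \sum_(q | A q) \prod_j hybrid i j (q j) (x 0 j).

Definition hybrid_field A x : 'rV[R]_d := \sum_i hybrid_sum A i x *: delta_mx 0 i.

Let hybrid_derivable i j a t : derivable (hybrid i j a) t 1.
Proof.
by rewrite /hybrid; case: ifP => // _; case: ifP => // _; have [] := Phi_derive a t.
Qed.

Let hybrid_derive i j a : continuous (derive1 (hybrid i j a)).
Proof.
rewrite /hybrid; case: ifP => // _; case: ifP => // _.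
have -> : derive1 (Phi a) = eta a \- beta a.
  by apply/funext => t; rewrite derive1E; have [_ ->] := Phi_derive a t.
by move=> t; apply: cvgB; apply: differentiable_continuous; apply/derivable1_diffP.
Qed.

Let hybrid_prod_C1 i q : C1 (fun x => \prod_j hybrid i j (q j) (x 0 j)).
Proof.
by apply: (@C1_prod _ _ _ _ _ (fun j x => hybrid i j (q j) (x 0 j))) => j; exact: C1_coord.
Qed.

Let hybrid_sum_C1 A i : C1 (hybrid_sum A i).
Proof. by apply: C1_sum => q; exact: hybrid_prod_C1. Qed.

Lemma hybrid_field_C1 A : C1 (hybrid_field A).
Proof. by apply: C1_sum => i; exact: C1Z. Qed.

Lemma hybrid_fieldE A x i : hybrid_field A x 0 i = hybrid_sum A i x.
Proof.
rewrite summxE (bigD1 i)//= big1 ?addr0 => [|j ji]; first by rewrite !mxE !eqxx mulr1.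
by rewrite !mxE eq_sym (negbTE ji) andbF mulr0.
Qed.

Lemma hybrid_field_support A x : hybrid_field A x != 0 -> exists2 q, A q & cell_box q x.
Proof.
move=> phi0; apply: contrapT => /forall2NP nq; case/negP: phi0; apply/eqP/rowP => i.
rewrite hybrid_fieldE mxE; apply: big1 => q Aq.
have [//|/existsNP[j /negP xj]] := nq q.
have [e b p] := supp xj.
by rewrite (bigD1 j)//= /hybrid; case: ifP => _; [|case: ifP => _]; rewrite ?e ?b ?p mul0r.
Qed.

(** [J] is finite, so the closed boxes of the selected cells have a compact union, and this union
    contains the support. *)
Lemma hybrid_field_C1c (Omega : set 'rV[R]_d) A :
  (forall q, A q -> cell_box q `<=` Omega) -> C1c Omega (hybrid_field A).
Proof.
move=> AO; pose B := \big[setU/set0]_(q | A q) cell_box q.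
have cB : compact B.
  apply: bigsetU_compact => q _.
  rewrite (_ : cell_box q = [set x | forall i, `[lo (q i), hi (q i)]%classic (x ord0 i)]).
    by apply: (@rV_compact _ _ (fun i => `[lo (q i), hi (q i)]%classic)) => i; exact: segment_compact.
  by apply/seteqP; split => x /= xq i; have := xq i; rewrite in_itv.
have clB : closure [set x | hybrid_field A x != 0] `<=` B.
  rewrite closureE; apply: smallest_sub.
    by apply: (compact_closed _ cB); exact: (@norm_hausdorff R 'rV[R]_d).
  move=> x /hybrid_field_support[q Aq xq].
  by rewrite /B (bigD1 q)//=; left.
split; [exact: (hybrid_field_C1 A).1|exact: (hybrid_field_C1 A).2| |].
  by apply: subclosed_compact cB clB; exact: closed_closure.
apply: subset_trans clB _; rewrite /B.
by apply: (big_ind (fun B => B `<=` Omega)) => // ? ? ? ?; rewrite subUset.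
Qed.

(* The divergence telescopes over [mixed 0], ..., [mixed d]. *)
Let mixed (k : nat) q x := \prod_(j < d) (if (j < k)%N then beta (q j) else eta (q j)) (x 0 j).

Lemma hybrid_field_divergence A x : divergence (hybrid_field A) x =
  \sum_(q | A q) (\prod_j eta (q j) (x 0 j) - \prod_j beta (q j) (x 0 j)).
Proof.
rewrite /divergence; under eq_bigr => i _.
  rewrite (_ : (fun y => _) = hybrid_sum A i); last by apply/funext => y; rewrite hybrid_fieldE.
  rewrite derive_sum_seq//.
  over.
rewrite exchange_big; apply: eq_bigr => q _.
(* Differentiating [Phi] gives [eta - beta], so the i-th term exchanges one factor and is a
   difference of consecutive mixed products. *)
transitivity (\sum_(i < d) (mixed i q x - mixed i.+1 q x)); last first.
  rewrite -(big_mkord xpredT (fun i => mixed i q x - mixed i.+1 q x)).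
  under eq_bigr do rewrite -opprB.
  rewrite sumrN telescope_sumr// opprB; congr (_ - _).
  by apply: eq_bigr => j _; rewrite ltn_ord.
apply: eq_bigr => i _; rewrite (derive_prod_coord (f := fun j => hybrid i j (q j)))//.
rewrite /mixed [X in _ = X - _](bigD1 i)//= [X in _ = _ - X](bigD1 i)//= ltnn ltnSn.
rewrite [X in _ = _ - _ * X](_ : _ =
  \prod_(j < d | j != i) (if (j < i)%N then beta (q j) else eta (q j)) (x 0 j)).
  rewrite -mulrBl; congr (_ * _).
    by rewrite derive1E /hybrid ltnn eqxx; have [_ ->] := Phi_derive (q i) (x 0 i).
  by apply: eq_bigr => j ji; rewrite /hybrid (negbTE ji).
by apply: eq_bigr => j ji; rewrite ltnS leq_eqVlt (negbTE ji : val j == val i = false).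
Qed.

(** With absolute values inside, the sum extends from [A] to all [q] and factors by distributivity:
    at most [K] from the coordinate that carries [Phi], at most 1 from each other one. The factor
    [d] comes from bounding the Euclidean norm by the sum of the components. *)
Lemma enorm_hybrid_field A x : enorm (hybrid_field A x) <= d%:R * K.
Proof.
apply: le_trans (enorm_le_sum _) _.
have -> : d%:R * K = \sum_(i < d) K by rewrite sumr_const card_ord mulr_natl.
apply: ler_sum => i _; rewrite hybrid_fieldE.
have H : `|hybrid_sum A i x| <= \sum_(q : {ffun 'I_d -> J}) \prod_j `|hybrid i j (q j) (x 0 j)|.
  apply: le_trans (ler_norm_sum _ _ _) _; rewrite big_mkcond/=.
  by apply: ler_sum => q _; case: ifP => _; rewrite ?normr_prod// prodr_ge0.
apply: (le_trans H); rewrite -(bigA_distr_bigA (fun j a => `|hybrid i j a (x 0 j)|)).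
apply: (@le_trans _ _ (\prod_(j < d) (if j == i then K else 1))).
  apply: ler_prod => j _; rewrite sumr_ge0//=.
  have [->|ji] := eqVneq j i; first by rewrite /hybrid ltnn eqxx.
  under eq_bigr do rewrite /hybrid (negbTE ji).
  case: (j < i)%N.
    by under eq_bigr do rewrite ger0_norm//.
  by under eq_bigr do rewrite ger0_norm//.
by rewrite (bigD1 i)//= eqxx big1 ?mulr1// => j /negbTE ->.
Qed.

End test_field.

(** * Integrals of derivatives of compactly supported functions *)

Section integral_derivative.
Context (R : realType).
Local Open Scope ereal_scope.

Lemma integral_derive_compact (k : R -> R) (M : R) :
  (forall t, derivable k t 1%R) -> continuous (derive1 k) ->
  (forall t, (M < `|t|)%R -> k t = 0%R) ->
  \int[@lebesgue_measure R]_t (derive1 k t)%:E = 0.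
Proof.
move=> dk ck k0; pose L := (`|M| + 1)%R.
have ML : (M < L)%R by rewrite /L (le_lt_trans (ler_norm _))// ltrDl.
have L0 : (0 < L)%R by rewrite /L ltr_wpDl.
have kL t : (L <= `|t|)%R -> derive1 k t = 0%R.
  move=> Lt; rewrite derive1E (@near_eq_derive _ _ _ k (cst 0%R)) ?derive_cst//.
  have oM : open [set s : R | (M < `|s|)%R].
    apply: (@open_comp _ _ (fun s : R => `|s|%R) [set y | (M < y)%R]).
      by move=> s _; exact: norm_continuous.
    exact: open_gt.
  have : nbhs t [set s : R | (M < `|s|)%R].
    by apply: open_nbhs_nbhs; split => //=; exact: lt_le_trans Lt.
  by apply: filterS => s /= /k0.
transitivity (\int[@lebesgue_measure R]_(t in `[(- L)%R, L]) (derive1 k t)%:E).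
  rewrite [RHS]integral_mkcond; apply: eq_integral => t _.
  rewrite patchE; case: ifPn => //; rewrite notin_setE /= in_itv/= => tL.
  rewrite kL// leNgt; apply/negP; rewrite ltr_norml => /andP[t1 t2].
  by apply: tL; rewrite !ltW.
rewrite (@continuous_FTC2 R (derive1 k) k).
- by rewrite !k0 ?subee// ?normrN gtr0_norm.
- by rewrite gtrN.
- exact: continuous_subspaceT.
- have ct t : k x @[x --> t] --> k t.
    by apply: differentiable_continuous; apply/derivable1_diffP.
  split => //; [exact: cvg_at_right_filter|exact: cvg_at_left_filter].
- by [].
Qed.

Lemma lebesgue_rV_bounded_lty n (A : set 'rV[R]_n) (M : R) :
  measurable A -> (forall x i, A x -> (`|x 0 i| <= M)%R) ->
  lebesgue_rV R n A < +oo.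
Proof.
move=> mA AM; pose B := fun i : 'I_n => `[(- M)%R, M]%classic : set R.
apply: (@le_lt_trans _ _ (lebesgue_rV R n [set v | forall i, B i (v 0%R i)])).
  rewrite le_measure ?inE//; first by apply: measurable_box_rV => i; exact: measurable_itv.
  by move=> x Ax i; rewrite /B /= in_itv/= -ler_norml; exact: AM.
rewrite lebesgue_rV_box => [|i]; last exact: measurable_itv.
suff /fin_numP[_ +] : \prod_(i < n) @lebesgue_measure R (B i) \is a fin_num.
  by rewrite ltey.
apply: (big_ind (fun x => x \is a fin_num)) => //.
  by move=> x y; exact: fin_numM.
move=> i _; rewrite /B lebesgue_measure_itv/=; by case: ifPn.
Qed.

Lemma integrable_compact_rV n (f : 'rV[R]_n -> R) (M : R) : continuous f ->
  (forall (x : 'rV[R]_n) i, (M < `|x 0 i|)%R -> f x = 0%R) ->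
  (lebesgue_rV R n).-integrable setT (EFin \o f).
Proof.
move=> cf f0; pose B := [set x : 'rV[R]_n | forall i, `[(- M)%R, M]%classic (x 0%R i)].
have mB : measurable B.
  by apply: (@measurable_box_rV R n (fun=> `[(- M)%R, M]%classic)) => i; exact: measurable_itv.
have BE x : B x -> forall i, (`|x 0 i| <= M)%R.
  by move=> Bx i; have := Bx i; rewrite /= in_itv/= -ler_norml.
have -> : EFin \o f = (EFin \o f) \_ B.
  apply/funext => x; rewrite patchE; case: ifPn => //; rewrite notin_setE => /existsNP[i xi].
  rewrite /= (f0 x i)// ltNge; apply/negP => xM; apply: xi.
  by rewrite /= in_itv/= -ler_norml.
apply: (integrable_mkcond (EFin \o f) mB).1; apply: (@measurable_bounded_integrable _ _ _ (lebesgue_rV R n) f B) => //.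
- by apply: (@lebesgue_rV_bounded_lty _ _ M) => // x j /BE; exact.
- by apply: measurable_funTS; exact: continuous_measurable_rV.
- have cB : compact B.
    by apply: (@rV_compact _ _ (fun i => `[(- M)%R, M]%classic)) => i; exact: segment_compact.
  have := compact_bounded (continuous_compact (continuous_subspaceT cf) cB).
  by move=> [K [Kr KP]]; exists K; split => // y Ky x Bx; apply: KP => //; exists x.
Qed.

Lemma derive_compact_rV n (g : 'rV[R]_n -> R) (M : R) (v x : 'rV[R]_n) i :
  (forall (x : 'rV[R]_n) j, (M < `|x 0 j|)%R -> g x = 0%R) -> (M < `|x 0 i|)%R -> 'D_v g x = 0%R.
Proof.
move=> g0 Mx; rewrite (@near_eq_derive _ _ _ g (cst 0%R)) ?derive_cst//.
have : nbhs x [set y : 'rV[R]_n | (M < `|y 0%R i|)%R].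
  apply: open_nbhs_nbhs; split => //.
  apply: (@open_comp _ _ (fun y : 'rV[R]_n => `|y 0%R i|%R) [set t | (M < t)%R]).
    move=> y _; apply: (@continuous_comp _ _ _ (fun y : 'rV[R]_n => y 0%R i) (fun t : R => `|t|%R)).
      exact: coord_continuous.
    exact: norm_continuous.
  exact: open_gt.
by apply: filterS => y /= /g0.
Qed.

Lemma cons_rV_shift0 n (t h : R) (v : 'rV[R]_n) :
  (h *: delta_mx 0 0 + cons_rV (t, v))%R = cons_rV ((h *: 1 + t)%R, v).
Proof.
apply/rowP => j; rewrite !mxE/=; case: split_ordP => k ->; rewrite ?mxE.
  have -> : lshift n k = 0%R by apply/val_inj; rewrite /= ord1.
  by rewrite !eqxx.
by rewrite (_ : (rshift 1 k == 0%R) = false) ?andbF ?mulr0 ?add0r.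
Qed.

Lemma cons_rV_shift n (t h : R) (v : 'rV[R]_n) (i : 'I_n) :
  (h *: delta_mx 0 (lift ord0 i) + cons_rV (t, v))%R = cons_rV (t, (h *: delta_mx 0 i + v)%R).
Proof.
apply/rowP => j; rewrite !mxE/=; case: split_ordP => k ->; rewrite ?mxE.
  rewrite (_ : (lshift n k == lift ord0 i) = false) ?andbF ?mulr0 ?add0r//.
  by apply/negbTE; rewrite -val_eqE/= ord1.
by congr (_ * _ + _)%R; rewrite -val_eqE.
Qed.

Lemma cons_rV_continuous1 n (v : 'rV[R]_n) : continuous (fun t : R => cons_rV (t, v)).
Proof.
move=> t; apply/cvg_ballP => e e0.
have : nbhs t (ball t e) by exact: nbhsx_ballx.
apply: filterS => s ts; split => // i j; rewrite ord1 !mxE.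
by case: split_ordP => k _; rewrite ?mxE//; exact: ballxx.
Qed.

Lemma cons_rV_continuous2 n (t : R) : continuous (fun v : 'rV[R]_n => cons_rV (t, v)).
Proof.
move=> v; apply/(@cvg_ballP _ _ _ (nbhs v)) => e e0.
have : nbhs v (ball v e) by exact: nbhsx_ballx.
apply: filterS => w [_ vw]; split => // i j; rewrite ord1 !mxE.
by case: split_ordP => k _; rewrite ?mxE//; exact: ballxx.
Qed.

Lemma cons_rV0 n (t : R) (v : 'rV[R]_n) : cons_rV (t, v) 0%R 0%R = t.
Proof. by have /(congr1 fst) := cons_rVK (t, v). Qed.

Lemma cons_rV_lift n (t : R) (v : 'rV[R]_n) i : cons_rV (t, v) 0%R (lift ord0 i) = v 0%R i.
Proof.
rewrite mxE; case: split_ordP => k //= ik.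
  by move/(congr1 val): ik; rewrite /= ord1.
by have -> : k = i by apply/val_inj; move/(congr1 val): ik => /= -[].
Qed.

(** The two difference quotients are the same function, so both existence and value transfer. This
    identifies partial derivatives with derivatives of slices along [cons_rV]. *)
Lemma derive_along (V V' : normedModType R) (g : V -> R) (k : V' -> R) a v a' v' :
  (forall h : R, k (h *: v' + a') = g (h *: v + a))%R ->
  'D_v' k a' = 'D_v g a /\ (derivable g a v -> derivable k a' v').
Proof.
move=> kg; have E : (fun h : R => h^-1 *: ((k \o shift a') (h *: v') - k a'))%R =
    (fun h => h^-1 *: ((g \o shift a) (h *: v) - g a))%R.
  apply/funext => h /=; rewrite kg.
  by have := kg 0%R; rewrite !scale0r !add0r => ->.
by rewrite /derive /derivable E.
Qed.

(** Induction on the dimension with Fubini, since [lebesgue_rV] is built by adding a coordinate in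
    front. For i = 0 the inner integral is the one over the first coordinate and vanishes by the
    fundamental theorem of calculus; otherwise the slices at a fixed first coordinate fall under the
    induction hypothesis. *)
Lemma integral_derive_rV n (g : 'rV[R]_n -> R) (i : 'I_n) (M : R) :
  (forall x, derivable g x (delta_mx 0%R i)) -> continuous ('D_(delta_mx 0%R i) g) ->
  (forall (x : 'rV[R]_n) j, (M < `|x 0 j|)%R -> g x = 0%R) ->
  \int[lebesgue_rV R n]_x ('D_(delta_mx 0%R i) g x)%:E = 0.
Proof.
elim: n g i => [g []//|n IH] g i dg cg g0.
set f := 'D_(delta_mx 0%R i) g.
have f0 (x : 'rV[R]_n.+1) j : (M < `|x 0 j|)%R -> f x = 0%R by exact: derive_compact_rV.
pose prod := (@lebesgue_measure R \x lebesgue_rV R n).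
have mf : measurable_fun setT (EFin \o f).
  by apply/measurable_EFinP; exact: continuous_measurable_rV.
have intf : prod.-integrable setT ((EFin \o f) \o @cons_rV R n).
  have /integrableP[_ +] := integrable_compact_rV cg f0.
  move=> foo; apply/integrableP; split.
    by apply: measurableT_comp => //; exact: measurable_cons_rV.
  apply: le_lt_trans foo.
  rewrite /= /cons_measure ge0_integral_pushforward//.
  by apply/measurable_EFinP; apply: measurableT_comp => //; exact: continuous_measurable_rV.
rewrite /= /cons_measure integral_pushforward//=.
rewrite preimage_setT.
have [i0|i0] := eqVneq i 0%R.
  rewrite -integral21_prod_meas1//; apply: integral0_eq => v _.
  have fE : derive1 (fun t => g (cons_rV (t, v))) = (fun t => f (cons_rV (t, v))).
    apply/funext => t; rewrite derive1E /f i0.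
    by apply: (derive_along _).1 => h; rewrite cons_rV_shift0.
  rewrite /fubini_G -[RHS](@integral_derive_compact (fun t => g (cons_rV (t, v))) M).
  - by rewrite fE.
  - move=> t; have := dg (cons_rV (t, v)); rewrite i0.
    by apply: (derive_along _).2 => h; rewrite cons_rV_shift0.
  - rewrite fE => t.
    apply: (@continuous_comp _ _ _ (fun t : R => cons_rV (t, v)) f); last exact: cg.
    exact: cons_rV_continuous1.
  - move=> t Mt; apply: (g0 _ 0%R).
    by rewrite cons_rV0.
have [j ij] : exists j, i = lift ord0 j.
  by case: (unliftP ord0 i) i0 => [j ->|->] => [_|/eqP]; [exists j|].

rewrite -integral12_prod_meas1//; apply: integral0_eq => t _.
have fE : 'D_(delta_mx 0%R j) (fun v => g (cons_rV (t, v))) = (fun v => f (cons_rV (t, v))).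
  apply/funext => v; rewrite /f ij.
  by apply: (derive_along _).1 => h; rewrite cons_rV_shift.
rewrite /fubini_F -[RHS](IH (fun v => g (cons_rV (t, v))) j).
- by apply: eq_integral => w _; have /= -> := congr1 (fun k => k w) fE.
- move=> v; have := dg (cons_rV (t, v)); rewrite ij.
  by apply: (derive_along _).2 => h; rewrite cons_rV_shift.
- rewrite fE => v.
  apply: (@continuous_comp _ _ _ (fun v : 'rV[R]_n => cons_rV (t, v)) f); last exact: cg.
  exact: cons_rV_continuous2.
- move=> v k Mk; apply: (g0 _ (lift ord0 k)).
  by rewrite cons_rV_lift.
Qed.

End integral_derivative.

(** * Divergence of C^1_c fields *)

Section divergence_theory.
Context (R : realType) (d : nat).
Implicit Types (Omega : set 'rV[R]_d) (phi : 'rV[R]_d -> 'rV[R]_d).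

Lemma coord_le_norm (x : 'rV[R]_d) i : `|x 0 i| <= `|x|.
Proof.
have /mapP[j Hj ->] : `|x ord0 i| \in [seq `|x p.1 p.2| | p : 'I_1 * 'I_d].
  by apply/mapP; exists (ord0, i) => //=; rewrite mem_enum.
by rewrite [leRHS]/Num.norm /= mx_normrE; apply/bigmax_geP; right => /=; exists j.
Qed.

Lemma continuous_sum (T : topologicalType) I (r : seq I) (P : pred I) (f : I -> T -> R) :
  (forall i, continuous (f i)) -> continuous (fun x => \sum_(i <- r | P i) f i x).
Proof.
move=> cf; elim: r => [|i r IH].
  by under eq_fun do rewrite big_nil; move=> x; exact: cvg_cst.
under eq_fun do rewrite big_cons.
by case: (P i) => // x; apply: cvgD; [exact: cf|exact: IH].
Qed.

Lemma derive_component phi (x v : 'rV[R]_d) i : (forall x, differentiable phi x) ->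
  'D_v (fun y => phi y 0 i) x = 'D_v phi x 0 i.
Proof. by move=> dphi; rewrite derive_mx ?mxE//; exact: diff_derivable. Qed.

Lemma derive_component_continuous Omega phi i v : C1c Omega phi ->
  continuous ('D_v (fun y => phi y 0 i)).
Proof.
move=> [dphi cphi _ _].
rewrite (_ : 'D_v _ = (fun x => 'D_v phi x 0 i)) => [x|].
  apply: (@continuous_comp _ _ _ ('D_v phi) (fun y : 'rV[R]_d => y 0 i)); first exact: cphi.
  exact: coord_continuous.
by apply/funext => x; rewrite derive_component.
Qed.

Lemma divergence_continuous Omega phi : C1c Omega phi -> continuous (divergence phi).
Proof.
by move=> phi1; apply: continuous_sum => i; exact: derive_component_continuous phi1.
Qed.

Lemma C1c_supported Omega phi : C1c Omega phi ->
  exists M : R, forall (x : 'rV[R]_d) j, M < `|x 0 j| -> phi x = 0.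
Proof.
move=> [_ _ /compact_bounded[M [_ MP]] _]; exists (M + 1) => x j xM.
apply/eqP; apply: contraLR xM => phix; rewrite -leNgt.
apply: (le_trans (coord_le_norm _ _)); apply: MP; first by rewrite ltrDl.
exact: subset_closure.
Qed.

Lemma divergence_out phi x : (forall x, differentiable phi x) ->
  ~ closure [set y | phi y != 0] x -> divergence phi x = 0.
Proof.
move=> dphi Sx; apply: big1 => i _.
rewrite derive_component// (@near_eq_derive _ _ _ phi (cst 0)) ?derive_cst ?mxE//.
have : nbhs x (~` closure [set x | phi x != 0]).
  by apply: open_nbhs_nbhs; split => //; apply: closed_openC; exact: closed_closure.
apply: filterS => y /= yc; apply/eqP; apply: contrapT => /negP phiy.
by apply: yc; exact: subset_closure.
Qed.

Lemma integral_divergence Omega phi : open Omega -> C1c Omega phi ->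
  (\int[lebesgue_rV R d]_(x in Omega) (divergence phi x)%:E = 0)%E.
Proof.
move=> oO phi1; have [M phi0] := C1c_supported phi1.
have phii0 i (x : 'rV[R]_d) j : M < `|x 0 j| -> phi x 0 i = 0.
  by move=> /phi0 ->; rewrite mxE.
rewrite integral_mkcond (_ : _ \_ _ = fun x => (divergence phi x)%:E); last first.
  apply/funext => x; rewrite patchE; case: ifPn => //; rewrite notin_setE => xO.
  have [dphi _ _ phiO] := phi1.
  by rewrite divergence_out// => /phiO.
under eq_integral do rewrite -sumEFin.
rewrite integral_sum//= => [|i].
  apply: big1 => i _; apply: (@integral_derive_rV _ _ _ _ M) => //.
  - move=> x; have [+ _ _ _] := phi1 => /(_ x)/(@diff_derivable _ _ _ _ _ (delta_mx 0 i)).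
    by move/derivable_mxP; exact.
  - exact: derive_component_continuous phi1.
  - exact: phii0.
apply: (@integrable_compact_rV _ _ _ M); first exact: derive_component_continuous phi1.
by move=> x j xM; apply: (@derive_compact_rV _ _ _ M _ _ j) => //; exact: phii0.
Qed.

Lemma divergence_bounded Omega phi : C1c Omega phi ->
  exists K : R, forall x, `|divergence phi x| <= K.
Proof.
move=> phi1; have [_ _ cphi _] := phi1.
have := compact_bounded (continuous_compact (continuous_subspaceT (divergence_continuous phi1)) cphi).
move=> [K [_ KP]]; exists (`|K| + 1) => x.
have [xS|xS] := pselect (closure [set x | phi x != 0] x).
  apply: KP; last by exists x.
  by rewrite (le_lt_trans (ler_norm _))// ltrDl.
have [dphi _ _ _] := phi1.
by rewrite divergence_out// normr0 addr_ge0.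
Qed.

(** Each test integral is [c] times the integral of a divergence, hence 0. This provides the
    minimization with a competitor of finite value. *)
Lemma tv_cst Omega (c : R) : open Omega -> (tv Omega (cst c) < +oo)%E.
Proof.
move=> oO; apply: (@le_lt_trans _ _ 0%E) => //.
apply: ge_ereal_sup => _ [phi [phi1 _] <-].
rewrite (_ : (fun x => _) = (fun x => c%:E * (divergence phi x)%:E)%E)//.
rewrite integralZl ?integral_divergence ?mule0//; first exact: open_measurable_rV.
have [M phi0] := C1c_supported phi1.
apply: (@integrableS _ _ _ _ setT) => //; first exact: open_measurable_rV.
apply: (@integrable_compact_rV _ _ _ M); first exact: divergence_continuous phi1.
move=> x j xM; apply: big1 => i _; apply: (@derive_compact_rV _ _ _ M _ _ j) => //.
by move=> y k /phi0 ->; rewrite mxE.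
Qed.

End divergence_theory.

(** * Fine and coarse grids *)

Section grid.
Context (R : realType).

Lemma is_derive_affine (f f' : R -> R) (c h t : R) : (forall s : R, is_derive s 1 f (f' s)) ->
  is_derive t 1 (fun s => f ((s - c) / h)) (f' ((t - c) / h) / h).
Proof.
move=> Df; have Dg : is_derive t 1 (fun s : R => (s - c) / h) (h^-1 : R).
  by apply: is_derive_eq; rewrite /GRing.scale/= subr0 mulr0 add0r mulr1.
exact: (is_derive1_comp (g := fun s => (s - c) / h)).
Qed.

Lemma continuous_affine (f : R -> R) (c h : R) : continuous f ->
  continuous (fun t => f ((t - c) / h)).
Proof.
move=> cf t; apply: (@continuous_comp _ _ _ (fun s : R => (s - c) / h) f); last exact: cf.
by apply: cvgM; [apply: cvgB; [exact: cvg_id|exact: cvg_cst]|exact: cvg_cst].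
Qed.

Lemma sum_bump (t : R) n : \sum_(i < n) bump (t - i%:R) = step t - step (t - n%:R).
Proof.
rewrite -(big_mkord xpredT (fun i => bump (t - i%:R))).
transitivity (\sum_(0 <= i < n) (- step (t - i.+1%:R) - - step (t - i%:R))).
  by apply: eq_bigr => i _; rewrite /bump opprK addrC -natr1 opprD addrA.
by rewrite telescope_sumr// subr0 opprK addrC.
Qed.

Lemma sum_bump_le1 (t : R) n : \sum_(i < n) bump (t - i%:R) <= 1.
Proof.
rewrite sum_bump lerBlDr; have /andP[_ s1] := step_bounds t.
by rewrite (le_trans s1)// lerDl; have /andP[] := step_bounds (t - n%:R).
Qed.

Context (a H : R) (N m : nat).
Hypotheses (H0 : 0 < H) (m0 : (0 < m)%N).
Let h := H / m%:R.
Let J : finType := ('I_N * 'I_m)%type.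

Definition coarse_pt (Q : 'I_N) : R := a + Q%:R * H.
Definition fine_pt (j : J) : R := coarse_pt j.1 + j.2%:R * h.
Definition fine_bump (j : J) (t : R) := bump ((t - fine_pt j) / h).
Definition coarse_bump (Q : 'I_N) (t : R) := bump ((t - coarse_pt Q) / H).
(** The weight m^-1 is the ratio of the masses of a fine and a coarse spline. The [m] fine splines
    of a cell share one coarse spline, so these weights add up to 1. *)
Definition shared_bump (j : J) (t : R) := m%:R^-1 * coarse_bump j.1 t.
(** To the right of both supports each of the two terms equals [h], and they cancel. *)
Definition transport (j : J) (t : R) :=
  h * Bump ((t - fine_pt j) / h) - h * Bump ((t - coarse_pt j.1) / H).

Let m0' : 0 < m%:R :> R. Proof. by rewrite ltr0n. Qed.
Let h0 : 0 < h. Proof. by rewrite divr_gt0. Qed.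
Let hm : H = m%:R * h. Proof. by rewrite /h mulrC divfK// gt_eqF. Qed.

Let bump' (t : R) := derive1 (@bump R) t.
Let is_derive_bump (t : R) : is_derive t 1 (@bump R) (bump' t).
Proof. by split; [exact: bump_derivable|rewrite /bump' derive1E]. Qed.

Lemma derivable_fine_bump j t : derivable (fine_bump j) t 1.
Proof. by have [] := is_derive_affine (fine_pt j) h t is_derive_bump. Qed.

Lemma derivable_coarse_bump Q t : derivable (coarse_bump Q) t 1.
Proof. by have [] := is_derive_affine (coarse_pt Q) H t is_derive_bump. Qed.

Lemma derive_fine_bump_continuous j : continuous (derive1 (fine_bump j)).
Proof.
rewrite (_ : derive1 _ = fun t => bump' ((t - fine_pt j) / h) / h) => [t|].
  apply: cvgM; last exact: cvg_cst.
  apply: (@continuous_affine bump' (fine_pt j) h); exact: bump_continuous_derive.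
by apply/funext => t; rewrite derive1E;
   have [_ ->] := is_derive_affine (fine_pt j) h t is_derive_bump.
Qed.

Lemma derive_coarse_bump_continuous Q : continuous (derive1 (coarse_bump Q)).
Proof.
rewrite (_ : derive1 _ = fun t => bump' ((t - coarse_pt Q) / H) / H) => [t|].
  apply: cvgM; last exact: cvg_cst.
  apply: (@continuous_affine bump' (coarse_pt Q) H); exact: bump_continuous_derive.
by apply/funext => t; rewrite derive1E;
   have [_ ->] := is_derive_affine (coarse_pt Q) H t is_derive_bump.
Qed.

Lemma derivable_shared_bump j t : derivable (shared_bump j) t 1.
Proof. by apply: derivableM => //; exact: derivable_coarse_bump. Qed.

Lemma derive_shared_bump_continuous j : continuous (derive1 (shared_bump j)).
Proof.
rewrite (_ : derive1 _ = fun t => m%:R^-1 * derive1 (coarse_bump j.1) t) => [t|].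
  by apply: cvgM; [exact: cvg_cst|exact: derive_coarse_bump_continuous].
apply/funext => t; rewrite !derive1E; have dc := @derivable_coarse_bump j.1 t.
by rewrite (@deriveZ _ _ _ (coarse_bump j.1) m%:R^-1).
Qed.

Lemma is_derive_transport j (t : R) :
  is_derive t 1 (transport j) (fine_bump j t - shared_bump j t).
Proof.
have D1 := is_derive_affine (fine_pt j) h t (@is_derive_Bump R).
have D2 := is_derive_affine (coarse_pt j.1) H t (@is_derive_Bump R).
apply: is_derive_eq; rewrite /GRing.scale/= /fine_bump /shared_bump /coarse_bump /h.
by field; rewrite !gt_eqF.
Qed.

Lemma fine_bump_ge0 j t : 0 <= fine_bump j t. Proof. exact: bump_ge0. Qed.

Lemma coarse_bump_ge0 Q t : 0 <= coarse_bump Q t. Proof. exact: bump_ge0. Qed.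

Lemma shared_bump_ge0 j t : 0 <= shared_bump j t.
Proof. by rewrite mulr_ge0 ?invr_ge0 ?coarse_bump_ge0. Qed.

Lemma sum_fine_bump t :
  \sum_j fine_bump j t = step ((t - a) / h) - step ((t - a) / h - (N * m)%:R).
Proof.
rewrite -(pair_bigA _ (fun Q r => fine_bump (Q, r) t))/=.
transitivity (\sum_(Q < N)
    (step ((t - a) / h - (Q * m)%:R) - step ((t - a) / h - (Q.+1 * m)%:R))).
  apply: eq_bigr => Q _; rewrite mulSn addnC natrD opprD addrA -sum_bump.
  apply: eq_bigr => r _; congr bump; rewrite /fine_pt/= /coarse_pt hm natrM.
  by field; rewrite gt_eqF.
rewrite -(big_mkord xpredT (fun Q => step ((t - a) / h - (Q * m)%:R) -
  step ((t - a) / h - (Q.+1 * m)%:R))).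
under eq_bigr do rewrite -opprB.
by rewrite sumrN telescope_sumr// opprB mul0n subr0.
Qed.

Lemma sum_fine_bump_le1 t : \sum_j fine_bump j t <= 1.
Proof.
rewrite sum_fine_bump lerBlDr; have /andP[_ s1] := step_bounds ((t - a) / h).
by rewrite (le_trans s1)// lerDl; have /andP[] := step_bounds ((t - a) / h - (N * m)%:R).
Qed.

(** The splines sum to 1 only two fine meshes after the origin, where [step] reaches 1; the margin
    is stated with the larger [H] to be independent of [m]. *)
Lemma sum_fine_bump1 t : a + 2 * H <= t <= a + N%:R * H -> \sum_j fine_bump j t = 1.
Proof.
move=> /andP[t1 t2]; rewrite sum_fine_bump step_ge2; last first.
  rewrite ler_pdivlMr// lerBrDl; apply: le_trans t1; rewrite lerD2l ler_pM2l//.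
  by rewrite hm ler_peMl// ?(ltW h0)// ler1n.
rewrite step_le0 ?subr0// subr_le0 ler_pdivrMr// lerBlDl (le_trans t2)//.
by rewrite lerD2l natrM hm mulrA.
Qed.

Lemma sum_coarse_bump_le1 t : \sum_Q coarse_bump Q t <= 1.
Proof.
apply: le_trans (sum_bump_le1 ((t - a) / H) N).
rewrite le_eqVlt; apply/orP; left; apply/eqP; apply: eq_bigr => Q _; congr bump.
by rewrite /coarse_pt; field; rewrite gt_eqF.
Qed.

Lemma sum_shared_bump_le1 t : \sum_j shared_bump j t <= 1.
Proof.
rewrite -(pair_bigA _ (fun Q r => shared_bump (Q, r) t))/=.
apply: le_trans (sum_coarse_bump_le1 t).
apply: ler_sum => Q _; rewrite /shared_bump/= sumr_const card_ord.
by rewrite -(mulr_natl (_ * coarse_bump Q t) m) mulrA divff ?mul1r// gt_eqF.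
Qed.

Lemma fine_bump_support j t : fine_bump j t != 0 -> fine_pt j <= t <= fine_pt j + 3 * h.
Proof.
move=> jt; have {jt} : ~~ (((t - fine_pt j) / h <= 0) || (3 <= (t - fine_pt j) / h)).
  by apply: contra jt => jt; apply/eqP; exact: bump_eq0.
rewrite negb_or -!ltNge => /andP[]; rewrite pmulr_lgt0 ?invr_gt0// subr_gt0 => /ltW ->.
by rewrite ltr_pdivrMr// ltrBlDl => /ltW.
Qed.

(** One interval serves all three functions: j.2 + 3 <= 3 * m, so the support of a fine spline lies
    in that of the coarse spline of its cell. *)
Lemma grid_support j t : ~~ (coarse_pt j.1 <= t <= coarse_pt j.1 + 3 * H) ->
  [/\ fine_bump j t = 0, shared_bump j t = 0 & transport j t = 0].
Proof.
have j0 : 0 <= j.2%:R * h by rewrite mulr_ge0// ltW.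
rewrite negb_and -!ltNge => /orP[t1|t2].
  have c1 : (t - coarse_pt j.1) / H <= 0.
    by rewrite pmulr_lle0 ?invr_gt0// subr_le0 ltW.
  have f1 : (t - fine_pt j) / h <= 0.
    by rewrite pmulr_lle0 ?invr_gt0// subr_le0 (le_trans (ltW t1))// lerDl.
  rewrite /fine_bump /shared_bump /coarse_bump /transport !bump_eq0 ?c1 ?f1//.
  by rewrite !Bump_le0// !mulr0 subr0.
have c3 : 3 <= (t - coarse_pt j.1) / H by rewrite ler_pdivlMr// lerBrDl ltW.
have f3 : 3 <= (t - fine_pt j) / h.
  rewrite ler_pdivlMr// lerBrDl (le_trans _ (ltW t2))// /fine_pt -addrA lerD2l.
  rewrite -mulrDl [in leRHS]hm mulrA ler_pM2r//.
  have jm : j.2%:R + 1 <= m%:R :> R by rewrite natr1 ler_nat.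
  have m1 : 1 <= m%:R :> R by rewrite ler1n.
  lra.
rewrite /fine_bump /shared_bump /coarse_bump /transport !bump_eq0 ?c3 ?f3 ?orbT//.
by rewrite !Bump_ge3// mulr0 subrr.
Qed.

(** Each term is at most 36 * h = 2 * 18 * h, and a coarse cell has [m] of them, which makes 36 * H
    per cell; boundedly many cells overlap at [t]. The refinement [m] cancels. *)
Lemma sum_transport t : \sum_j `|transport j t| <= 180 * H.
Proof.
(* [g] is 1 on [0, 3] and its integer translates sum to at most 5, whence 180 = 36 * 5. *)
pose g (s : R) : R := \sum_(i < 5) bump (s + 2 - i%:R).
have g0 s : 0 <= g s by apply: sumr_ge0 => i _; exact: bump_ge0.
have g1 s : 0 <= s <= 3 -> g s = 1.
  move=> /andP[s0 s3]; rewrite /g sum_bump step_ge2; last by lra.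
  by rewrite step_le0 ?subr0//; lra.
have B18 s : `|Bump s| <= 18 :> R.
  have [s0|s0] := leP s 0; first by rewrite Bump_le0// normr0.
  have [s3|s3] := leP 3 s; first by rewrite Bump_ge3// normr1 ler1n.
  by rewrite Bump_bound// !ltW.
have Tg j : `|transport j t| <= 36 * h * g ((t - coarse_pt j.1) / H).
  have [tj|/grid_support[_ _ ->]] := boolP (coarse_pt j.1 <= t <= coarse_pt j.1 + 3 * H); last first.
    by rewrite normr0 !mulr_ge0// ltW.
  rewrite g1; last first.
    move: tj => /andP[t1 t2]; rewrite divr_ge0 ?subr_ge0 ?(ltW H0)//=.
    by rewrite ler_pdivrMr// lerBlDl.
  rewrite mulr1 /transport -mulrBr normrM gtr0_norm// mulrC ler_pM2r//.
  have b1 := B18 ((t - fine_pt j) / h); have b2 := B18 ((t - coarse_pt j.1) / H).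
  by apply: le_trans (ler_normB _ _) _; lra.
apply: le_trans (ler_sum _ (fun j _ => Tg j)) _.
rewrite -(pair_bigA _ (fun (Q : 'I_N) (r : 'I_m) => 36 * h * g ((t - coarse_pt Q) / H)))/=.
rewrite (_ : 180 * H = 36 * H * \sum_(i < 5) 1); last first.
  by rewrite sumr_const card_ord; ring.
under eq_bigr do rewrite sumr_const card_ord -(mulr_natl (36 * h * _) m) mulrA.
rewrite -mulr_sumr (_ : m%:R * (36 * h) = 36 * H); last by rewrite hm; ring.
rewrite ler_pM2l ?mulr_gt0// /g exchange_big; apply: ler_sum => i _.
apply: le_trans (sum_bump_le1 ((t - a) / H + 2 - i%:R) N).
rewrite le_eqVlt; apply/orP; left; apply/eqP; apply: eq_bigr => Q _; congr bump.
by rewrite /coarse_pt; field; rewrite gt_eqF.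
Qed.

End grid.

(** * The L^1 estimate *)

Section bounded_integrals.
Context d (T : measurableType d) (R : realType) (mu : {measure set T -> \bar R}).
Implicit Types (A B : set T) (f g : T -> R) (C : R).

Lemma bounded_integrable A f C : measurable A -> (mu A < +oo)%E -> measurable_fun A f ->
  (forall x, A x -> `|f x| <= C) -> mu.-integrable A (EFin \o f).
Proof.
move=> mA Aoo mf fC; apply: measurable_bounded_integrable => //.
exists C; split; first exact: num_real.
by move=> y Cy x Ax; apply: le_trans (ltW Cy); exact: fC.
Qed.

Lemma normr_Rintegral_le A f C : measurable A -> (mu A < +oo)%E -> measurable_fun A f ->
  (forall x, A x -> `|f x| <= C) -> `|\int[mu]_(x in A) f x| <= C * fine (mu A).
Proof.
move=> mA Aoo mf fC; have fi := bounded_integrable mA Aoo mf fC.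
apply: le_trans (le_normr_Rintegral mA fi) _; rewrite -Rintegral_cst//.
apply: le_Rintegral => //; first exact: integrable_norm.
apply: (@bounded_integrable _ _ `|C|) => //.
Qed.

Lemma Rintegral_patch A B f : B `<=` A -> \int[mu]_(x in B) f x = \int[mu]_(x in A) (f \_ B) x.
Proof. by move=> BA; rewrite -Rintegral_mkcondr setIidr. Qed.

Lemma Rintegral_sum A I (s : seq I) (P : pred I) (F : I -> T -> R) : measurable A ->
  (forall i, mu.-integrable A (EFin \o F i)) ->
  \int[mu]_(x in A) (\sum_(i <- s | P i) F i x) = \sum_(i <- s | P i) \int[mu]_(x in A) F i x.
Proof.
move=> mA Fi; rewrite /Rintegral; under eq_integral do rewrite -sumEFin.
rewrite integral_sum// -sum_fine// => i _; exact: (integrable_fin_num mA (Fi i)).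
Qed.

End bounded_integrals.

(** * Total variation as a bound on test integrals *)

Section tv_estimate.
Context (R : realType) (d : nat) (Omega : set 'rV[R]_d) (oOmega : open Omega).
Notation mu := (lebesgue_rV R d).
Hypothesis Omega_lty : (mu Omega < +oo)%E.
Let mOmega : measurable Omega := open_measurable_rV oOmega.

Lemma C1cZ phi (c : R) : C1c Omega phi -> C1c Omega (fun x => c *: phi x).
Proof.
move=> [dphi cphi kphi phiO].
have S : closure [set x | c *: phi x != 0] `<=` closure [set x | phi x != 0].
  by apply: closure_subset => x /=; rewrite scaler_eq0 negb_or => /andP[].
split.
- by move=> x; apply: differentiableZ.
- move=> v; rewrite (_ : 'D_v _ = (fun x => c *: 'D_v phi x)) => [x|].
    by apply: (@cvgZl_tmp _ _ _ (nbhs x) _ c ('D_v phi)); exact: cphi.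
  by apply/funext => x; rewrite deriveZ//; exact: diff_derivable.
- by apply: subclosed_compact kphi S; exact: closed_closure.
- exact: subset_trans phiO.
Qed.

Lemma divergenceZ phi (c : R) x : C1c Omega phi ->
  divergence (fun x => c *: phi x) x = c * divergence phi x.
Proof.
move=> [dphi _ _ _]; rewrite /divergence mulr_sumr; apply: eq_bigr => i _.
rewrite !derive_component//; last by move=> y; exact: differentiableZ.
by rewrite deriveZ ?mxE//; exact: diff_derivable.
Qed.

Lemma enormZ (c : R) (v : 'rV[R]_d) : enorm (c *: v) = `|c| * enorm v.
Proof.
rewrite /enorm; under eq_bigr do rewrite mxE exprMn.
by rewrite -mulr_sumr sqrtrM ?sqr_ge0// sqrtr_sqr.
Qed.

Lemma tv_bound (u : 'rV[R]_d -> R) (C T c : R) phi :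
  measurable_fun setT u -> (forall x, `|u x| <= C) -> (tv Omega u <= T%:E)%E ->
  C1c Omega phi -> 0 < c -> (forall s, Omega s -> enorm (phi s) <= c) ->
  `|\int[mu]_(x in Omega) (u x * divergence phi x)| <= c * T.
Proof.
move=> mu_ uC uT phi1 c0 phic.
have [K divK] := divergence_bounded phi1.
have ui : mu.-integrable Omega (EFin \o (fun x => u x * divergence phi x)).
  apply: (@bounded_integrable _ _ _ _ _ _ (C * K)) => //.
    apply: measurable_funM; first exact: measurable_funTS.
    by apply: measurable_funTS; apply: continuous_measurable_rV; exact: divergence_continuous phi1.
  by move=> x _; rewrite normrM ler_pM.
(* [e] is a sign; the values 1 and -1 together bound the absolute value. *)
have H e : `|e| = 1 -> e * \int[mu]_(x in Omega) (u x * divergence phi x) <= c * T.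
  move=> e1; rewrite -ler_pdivrMl//.
  have : (\int[mu]_(x in Omega) (u x * divergence (fun x => (c^-1 * e) *: phi x) x)%:E <= T%:E)%E.
    apply: le_trans uT; apply: ereal_sup_ubound; exists (fun x => (c^-1 * e) *: phi x) => //.
    split; first exact: C1cZ.
    move=> s Os; rewrite enormZ normrM e1 mulr1 gtr0_norm ?invr_gt0//.
    by rewrite ler_pdivrMl// mulr1; exact: phic.
  under eq_integral do rewrite divergenceZ// mulrCA.
  have ei : mu.-integrable Omega (EFin \o (fun x => c^-1 * e * (u x * divergence phi x))).
    exact: (integrableZl mOmega (c^-1 * e) ui).
  rewrite -(fineK (integrable_fin_num mOmega ei)) lee_fin.
  by rewrite -/(Rintegral _ _ _) RintegralZl// mulrA.
rewrite ler_norml; apply/andP; split; last first.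
  by have := H 1; rewrite mul1r normr1; exact.
by have := H (-1); rewrite mulN1r normrN1 lerNl; exact.
Qed.

End tv_estimate.

(** * Spline cutoff of an open set and its transport field *)

Section cutoff.
Context (R : realType) (d : nat) (Omega U : set 'rV[R]_d).
Variables (a H : R) (N m : nat).
Hypotheses (H0 : 0 < H) (m0 : (0 < m)%N).
Hypothesis grid_Omega : forall x, Omega x -> forall i, a + 2 * H <= x 0 i <= a + N%:R * H.
Let h := H / m%:R.
Let J : finType := ('I_N * 'I_m)%type.
Implicit Types (q : {ffun 'I_d -> J}) (x : 'rV[R]_d).

Let coarse_box := cell_box (d := d) (J := J) (fun j => coarse_pt a H j.1)
  (fun j => coarse_pt a H j.1 + 3 * H).
Let fine_box := cell_box (d := d) (J := J) (@fine_pt R a H N m) (fun j => fine_pt a H j + 3 * h).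

(** The condition on the coarse box keeps the support of the field in [Omega]; the one on the fine
    box makes the cutoff vanish off [U]. *)
Definition admissible : pred {ffun 'I_d -> J} :=
  fun q => `[< coarse_box q `<=` Omega /\ fine_box q `<=` U >].

Definition fine_prod q x := \prod_i fine_bump a H (q i) (x 0 i).
Definition shared_prod q x := \prod_i shared_bump a H (q i) (x 0 i).
Definition cutoff x := \sum_(q | admissible q) fine_prod q x.
(** Every [shared_prod] is m^-d times the coarse spline of its cell, so smallness against finitely
    many coarse splines controls this sum whatever [U] and [m] are. *)
Definition residue x := \sum_(q | admissible q) shared_prod q x.
Definition cutoff_field := hybrid_field (d := d) (J := J) (@fine_bump R a H N m)
  (@shared_bump R a H N m) (@transport R a H N m) admissible.

Let h0 : 0 < h. Proof. by rewrite divr_gt0 ?ltr0n. Qed.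

Lemma fine_prod_ge0 q x : 0 <= fine_prod q x.
Proof. by apply: prodr_ge0 => i _; exact: fine_bump_ge0. Qed.

Lemma shared_prod_ge0 q x : 0 <= shared_prod q x.
Proof. by apply: prodr_ge0 => i _; exact: shared_bump_ge0. Qed.

Lemma fine_prod_continuous q : continuous (fine_prod q).
Proof.
apply: C1_continuous; apply: (@C1_prod _ _ _ _ _ (fun i x => fine_bump a H (q i) (x 0 i))) => i.
by apply: C1_coord => [t|]; [exact: derivable_fine_bump|exact: derive_fine_bump_continuous].
Qed.

Lemma shared_prod_continuous q : continuous (shared_prod q).
Proof.
apply: C1_continuous; apply: (@C1_prod _ _ _ _ _ (fun i x => shared_bump a H (q i) (x 0 i))) => i.
by apply: C1_coord => [t|]; [exact: derivable_shared_bump|exact: derive_shared_bump_continuous].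
Qed.

Lemma cutoff_continuous : continuous cutoff.
Proof. by apply: continuous_sum => q; exact: fine_prod_continuous. Qed.

Lemma sum_fine_prod x : \sum_q fine_prod q x = \prod_i \sum_(j : J) fine_bump a H j (x 0 i).
Proof. by rewrite (bigA_distr_bigA (fun i (j : J) => fine_bump a H j (x 0 i))). Qed.

Lemma cutoff_bounds x : 0 <= cutoff x <= 1.
Proof.
rewrite sumr_ge0 => [|q _]; last exact: fine_prod_ge0.
apply: (@le_trans _ _ (\sum_q fine_prod q x)).
  rewrite /cutoff big_mkcond; apply: ler_sum => q _.
  by case: ifP => // _; exact: fine_prod_ge0.
rewrite sum_fine_prod prodr_ile1// => i _; rewrite sum_fine_bump_le1// sumr_ge0// => j _.
exact: fine_bump_ge0.
Qed.

Lemma fine_prod_support q x : fine_prod q x != 0 -> fine_box q x.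
Proof.
move=> /prodf_neq0 qx i; have := qx i isT; exact: fine_bump_support.
Qed.

Lemma fine_box_coarse_box q x : fine_box q x -> coarse_box q x.
Proof.
move=> xq i; have /andP[x1 x2] := xq i; apply/andP; split.
  by apply: le_trans x1; rewrite lerDl mulr_ge0// ltW.
apply: le_trans x2 _; rewrite /fine_pt -addrA lerD2l -/h.
have -> : H = m%:R * h by rewrite /h mulrC divfK// gt_eqF// ltr0n.
rewrite -mulrDl mulrA ler_pM2r//.
have jm : (q i).2%:R + 1 <= m%:R :> R by rewrite natr1 ler_nat.
have m1 : 1 <= m%:R :> R by rewrite ler1n.
lra.
Qed.

Lemma cutoff_out x : ~ U x -> cutoff x = 0.
Proof.
move=> Ux; apply: big1 => q /asboolP[_ qU]; apply/eqP; apply: contrapT => /negP qx.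
by apply/Ux/qU/fine_prod_support.
Qed.

Let dist_lt (p x y c : R) : 0 < c -> p <= x <= p + 3 * c -> p <= y <= p + 3 * c ->
  `|x - y| < 4 * c.
Proof.
by move=> c0 /andP[? ?] /andP[? ?]; rewrite ltr_norml; apply/andP; split; lra.
Qed.

(** A spline that is nonzero at [x] has [x] in both of its boxes. Their sides are 3 * h and 3 * H,
    so they lie in the balls of radius 4 * h and 4 * H around [x]: every spline active at [x] is
    admissible, and the cutoff is there the full partition of unity. *)
Lemma cutoff_core x : core Omega (4 * H) x -> core U (4 * h) x -> cutoff x = 1.
Proof.
move=> xO xU; have Ox : Omega x by apply: (sub_core _ xO); rewrite mulr_gt0.
transitivity (\sum_q fine_prod q x); last first.
  rewrite sum_fine_prod big1// => i _; exact/sum_fine_bump1/grid_Omega.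
rewrite /cutoff big_mkcond; apply: eq_bigr => q _; case: ifPn => // /asboolPn Aq.
apply/eqP; rewrite eq_sym; apply: contrapT => /negP/fine_prod_support xq; apply: Aq.
split.
  move=> y yq; apply: xO; have {}xq := fine_box_coarse_box xq.
  split=> [|i j]; first by rewrite mulr_gt0.
  by rewrite ord1; exact: dist_lt (xq j) (yq j).
move=> y yq; apply: xU; split=> [|i j]; first by rewrite mulr_gt0.
by rewrite ord1; exact: dist_lt (xq j) (yq j).
Qed.

Lemma cutoff_field_C1c : C1c Omega cutoff_field.
Proof.
apply: (@hybrid_field_C1c _ _ _ _ _ _ (fun j => coarse_pt a H j.1)
  (fun j => coarse_pt a H j.1 + 3 * H)).
- by move=> *; exact: derivable_fine_bump.
- by move=> *; exact: derive_fine_bump_continuous.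
- by move=> *; exact: derivable_shared_bump.
- by move=> *; exact: derive_shared_bump_continuous.
- by move=> *; exact: is_derive_transport.
- by move=> *; exact: grid_support.
- by move=> q /asboolP[].
Qed.

Lemma divergence_cutoff_field x : divergence cutoff_field x = cutoff x - residue x.
Proof.
rewrite /cutoff /residue -sumrB; apply: hybrid_field_divergence.
- by move=> *; exact: derivable_fine_bump.
- by move=> *; exact: derive_fine_bump_continuous.
- by move=> *; exact: derivable_shared_bump.
- by move=> *; exact: derive_shared_bump_continuous.
- by move=> *; exact: is_derive_transport.
Qed.

Lemma enorm_cutoff_field x : enorm (cutoff_field x) <= d%:R * (180 * H).
Proof.
apply: enorm_hybrid_field.
- by move=> *; exact: fine_bump_ge0.
- by move=> *; exact: sum_fine_bump_le1.
- by move=> *; exact: shared_bump_ge0.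
- by move=> *; exact: sum_shared_bump_le1.
- by move=> *; exact: sum_transport.
Qed.

Lemma shared_prod_le1 q x : shared_prod q x <= 1.
Proof.
apply: prodr_ile1 => i _; rewrite shared_bump_ge0//=.
apply: le_trans (sum_shared_bump_le1 a N H0 m0 (x 0 i)).
by rewrite (bigD1 (q i))//= lerDl sumr_ge0// => j _; exact: shared_bump_ge0.
Qed.

Lemma shared_prodE q x : shared_prod q x =
  m%:R^-1 ^+ d * \prod_i coarse_bump a H ([ffun i => (q i).1] i) (x 0 i).
Proof.
rewrite /shared_prod /shared_bump big_split/= prodr_const card_ord; congr (_ * _).
by apply: eq_bigr => i _; rewrite ffunE.
Qed.

End cutoff.

(** * From open sets to measurable sets and to the L^1 norm *)

Section set_estimate.
Context (R : realType) (d : nat) (Omega : set 'rV[R]_d) (oOmega : open Omega).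
Notation mu := (lebesgue_rV R d).
Hypotheses (Omega_lty : (mu Omega < +oo)%E) (d0 : (0 < d)%N).
Let mOmega : measurable Omega := open_measurable_rV oOmega.
Variables (u1 u2 : 'rV[R]_d -> R) (C T : R).
Hypotheses (mu1 : measurable_fun setT u1) (mu2 : measurable_fun setT u2)
  (u1C : forall x, `|u1 x| <= C) (u2C : forall x, `|u2 x| <= C)
  (tv1 : (tv Omega u1 <= T%:E)%E) (tv2 : (tv Omega u2 <= T%:E)%E).
Variables (a H eps : R) (N : nat).
Hypotheses (H0 : 0 < H) (N0 : (0 < N)%N).
Hypothesis grid_Omega : forall x, Omega x -> forall i, a + 2 * H <= x 0 i <= a + N%:R * H.
Let u x := u1 x - u2 x.
Hypothesis weak : forall Q : {ffun 'I_d -> 'I_N},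
  `|\int[mu]_(x in Omega) (u x * \prod_i coarse_bump a H (Q i) (x 0 i))| <= eps / N%:R ^+ d.

Let C0 : 0 <= C. Proof. exact: le_trans (u1C 0). Qed.

Let mu_ : measurable_fun setT u. Proof. exact: measurable_funB. Qed.

Let uC x : `|u x| <= 2 * C.
Proof.
rewrite mulr2n mulrDl mul1r; apply: le_trans (ler_normB _ _) _.
by rewrite lerD.
Qed.

Let int_mul (v f : 'rV[R]_d -> R) (K : R) : measurable_fun setT v -> (forall x, `|v x| <= K) ->
  measurable_fun setT f -> (forall x, `|f x| <= 1) ->
  mu.-integrable Omega (EFin \o (fun x => v x * f x)).
Proof.
move=> mv vK mf f1; apply: (@bounded_integrable _ _ _ _ _ _ (K * 1)) => //.
  by apply: measurable_funTS; exact: measurable_funM.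
by move=> x _; rewrite normrM ler_pM.
Qed.

Let weak_fine (m : nat) (q : {ffun 'I_d -> 'I_N * 'I_m}) : (0 < m)%N ->
  `|\int[mu]_(x in Omega) (u x * shared_prod a H q x)| <= m%:R^-1 ^+ d * (eps / N%:R ^+ d).
Proof.
move=> m0; have m0' : 0 < m%:R :> R by rewrite ltr0n.
pose th (x : 'rV[R]_d) := \prod_i coarse_bump a H ([ffun i => (q i).1] i) (x 0 i).
have thE x : th x = m%:R ^+ d * shared_prod a H q x.
  by rewrite shared_prodE mulrA -exprMn mulfV ?gt_eqF// expr1n mul1r.
under eq_Rintegral do rewrite shared_prodE mulrCA.
rewrite RintegralZl//; last first.
  apply: (@bounded_integrable _ _ _ _ _ _ (2 * C * m%:R ^+ d)) => //.
    apply: measurable_funTS; apply: measurable_funM => //.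
    rewrite -/(th _) (_ : (fun x => _) = (fun x => m%:R ^+ d * shared_prod a H q x)).
      apply: measurable_funM => //; apply: continuous_measurable_rV.
      exact: shared_prod_continuous.
    by apply/funext => x; rewrite -thE.
  move=> x _; rewrite -/(th x) thE normrM ler_pM// normrM ger0_norm ?exprn_ge0//.
  rewrite ler_piMr ?exprn_ge0// ger0_norm ?shared_prod_ge0//; exact: shared_prod_le1.
by rewrite normrM ger0_norm ?exprn_ge0 ?invr_ge0// ler_wpM2l ?exprn_ge0 ?invr_ge0.
Qed.

(** With psi the cutoff and phi its field, u 1_U is the sum of u div phi, of [u] times the residue,
    and of u (1_U - psi). Total variation bounds the first integral, once for [u1] and once for
    [u2], hence the factor 2; [weak] bounds the second; the third lives on boundary layers. [m] is
    chosen after [U] and [e] and is absent from the bound. *)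
Lemma open_set_estimate (U : set 'rV[R]_d) (e : R) : open U -> U `<=` Omega -> 0 < e ->
  `|\int[mu]_(x in U) u x| <= 2 * (d%:R * (180 * H) * T) + eps +
     2 * C * fine (mu (Omega `\` core Omega (4 * H))) + e.
Proof.
move=> oU UO e0; have mU := open_measurable_rV oU.
have muoo (B : set 'rV[R]_d) : measurable B -> B `<=` Omega -> (mu B < +oo)%E.
  by move=> mB BO; apply: le_lt_trans Omega_lty; rewrite le_measure ?inE.
(* [2 * C] may be 0; adding 1 makes it a legitimate divisor. *)
have C10 : 0 < 2 * C + 1 by rewrite ltr_wpDl ?mulr_ge0.
have [r r0 Ur] := core_exhaust (muoo _ mU UO) oU (divr_gt0 e0 C10).
pose m := (Num.trunc (4 * H / r)).+1.
have m0 : (0 < m)%N by [].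
have m0' : 0 < m%:R :> R by rewrite ltr0n.
have mr : 4 * (H / m%:R) <= r.
  rewrite mulrA ler_pdivrMr// [r * _]mulrC -ler_pdivrMr// ltW//.
  exact: Num.Theory.truncnS_gt.
have {Ur mr}Ur := Ur _ (mulr_gt0 (ltr0Sn _ 3) (divr_gt0 H0 m0')) mr.
pose psi := cutoff Omega U a H N m.
pose phi := cutoff_field Omega U a H N m.
have mpsi : measurable_fun setT psi.
  by apply: continuous_measurable_rV; exact: cutoff_continuous.
(* [W] carries the error of the cutoff: a layer of [Omega] at the coarse scale, which stays in the
   bound, and a layer of [U] at the fine scale, of measure below e / (2 * C + 1). *)
pose W := (Omega `\` core Omega (4 * H)) `|` (U `\` core U (4 * (H / m%:R))).
have mW1 : measurable (Omega `\` core Omega (4 * H)).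
  by apply: measurableD => //; exact: core_measurable.
have mW2 : measurable (U `\` core U (4 * (H / m%:R))).
  by apply: measurableD => //; exact: core_measurable.
have mW : measurable W by exact: measurableU.
have WO : W `<=` Omega by move=> x [[]//|[/UO]].
pose D x := u x * (\1_U x - psi x).
have mind : measurable_fun setT (\1_U : 'rV[R]_d -> R) by exact: measurable_indic.
have psi01 x : `|\1_U x - psi x| <= 1.
  have /andP[p0 p1] : 0 <= psi x <= 1 by exact: cutoff_bounds.
  rewrite indicE ler_norml; case: (x \in U) => /=; apply/andP; split; lra.
have Di : mu.-integrable Omega (EFin \o D).
  by apply: int_mul uC _ psi01 => //; exact: measurable_funB.
have D0 x : Omega x -> ~ W x -> D x = 0.
  move=> Ox Wx; have xO : core Omega (4 * H) x.
    by apply: contrapT => xO; apply: Wx; left.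
  rewrite /D indicE; have [Ux|Ux] := pselect (U x).
    have xU : core U (4 * (H / m%:R)) x by apply: contrapT => xU; apply: Wx; right.
    by rewrite mem_set// /psi (cutoff_core H0 m0 grid_Omega xO xU) subrr mulr0.
  by rewrite memNset// /psi (cutoff_out _ _ _ H0 m0 Ux) subrr mulr0.
have phi1 : C1c Omega phi by exact: cutoff_field_C1c.
have divE x : divergence phi x = psi x - residue Omega U a H N m x.
  exact: divergence_cutoff_field.
have [K divK] := divergence_bounded phi1.
have mdiv : measurable_fun setT (divergence phi).
  by apply: continuous_measurable_rV; exact: divergence_continuous phi1.
have divi (v : 'rV[R]_d -> R) : measurable_fun setT v -> (forall x, `|v x| <= C) ->
    mu.-integrable Omega (EFin \o (fun x => v x * divergence phi x)).
  move=> mv vC; apply: (@bounded_integrable _ _ _ _ _ _ (C * K)) => //.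
    by apply: measurable_funTS; exact: measurable_funM.
  by move=> x _; rewrite normrM ler_pM.
pose G (q : {ffun 'I_d -> 'I_N * 'I_m}) x := u x * shared_prod a H q x.
have Gi q : mu.-integrable Omega (EFin \o G q).
  apply: int_mul uC _ _ => //.
    by apply: continuous_measurable_rV; exact: shared_prod_continuous.
  by move=> x; rewrite ger0_norm ?shared_prod_ge0//; exact: shared_prod_le1.
have Ri : mu.-integrable Omega (EFin \o (fun x => \sum_(q | admissible Omega U a H q) G q x)).
  rewrite (_ : _ \o _ = (fun x => \sum_(q | admissible Omega U a H q) (G q x)%:E)%E).
    by apply: integrable_sum => // q _; exact: Gi.
  by apply/funext => x; rewrite /= sumEFin.
have uE x : (u \_ U) x = u1 x * divergence phi x - u2 x * divergence phi x +
    \sum_(q | admissible Omega U a H q) G q x + D x.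
  rewrite -mulr_sumr -/(residue Omega U a H N m x) divE -mulrBl -/(u x) -mulrDr subrK -mulrDr.
  rewrite /D addrC subrK patchE indicE.
  by case: (x \in U); rewrite ?mulr1 ?mulr0.
have dB : mu.-integrable Omega (EFin \o (fun x => u1 x * divergence phi x - u2 x * divergence phi x)).
  exact: (integrableB mOmega (divi _ mu1 u1C) (divi _ mu2 u2C)).
have dBR : mu.-integrable Omega (EFin \o (fun x => u1 x * divergence phi x - u2 x * divergence phi x +
    \sum_(q | admissible Omega U a H q) G q x)).
  exact: (integrableD mOmega dB Ri).
rewrite (Rintegral_patch _ _ UO); under eq_Rintegral do rewrite uE.
rewrite RintegralD// RintegralD// RintegralB//; [|exact: divi..].
have c0 : 0 < d%:R * (180 * H) by rewrite !mulr_gt0// ltr0n.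
have phic s : Omega s -> enorm (phi s) <= d%:R * (180 * H).
  by move=> _; exact: enorm_cutoff_field.
have E1 := tv_bound oOmega Omega_lty mu1 u1C tv1 phi1 c0 phic.
have E2 := tv_bound oOmega Omega_lty mu2 u2C tv2 phi1 c0 phic.
(* There are (N * m)^d indices, each contributing at most m^-d * eps / N^d. *)
have E3 : `|\int[mu]_(x in Omega) (\sum_(q | admissible Omega U a H q) G q x)| <= eps.
  rewrite Rintegral_sum//; apply: le_trans (ler_norm_sum _ _ _) _.
  apply: (@le_trans _ _ (\sum_(q : {ffun 'I_d -> 'I_N * 'I_m}) m%:R^-1 ^+ d * (eps / N%:R ^+ d))).
    rewrite big_mkcond; apply: ler_sum => q _; case: ifP => _; first exact: weak_fine.
    exact: le_trans (weak_fine q m0).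
  rewrite sumr_const card_ffun card_prod !card_ord -(mulr_natl (m%:R^-1 ^+ d * _)) natrX natrM exprMn exprVn.
  rewrite le_eqVlt; apply/orP; left; apply/eqP; field.
  by rewrite !expf_neq0// pnatr_eq0 -lt0n.
have E4 : `|\int[mu]_(x in Omega) D x| <= 2 * C * fine (mu (Omega `\` core Omega (4 * H))) + e.
  rewrite (_ : \int[mu]_(x in Omega) D x = \int[mu]_(x in W) D x); last first.
    rewrite (Rintegral_patch _ _ WO); apply: eq_Rintegral => x /set_mem Ox; rewrite patchE.
    by case: ifPn => //; rewrite notin_setE => /(D0 _ Ox).
  apply: le_trans (normr_Rintegral_le mW (muoo _ mW WO) _ (C := 2 * C) _) _.
  - by apply: measurable_funTS; apply: measurable_funM => //; exact: measurable_funB.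
  - by move=> x _; rewrite /D normrM -[leRHS]mulr1 ler_pM.
  have WW : fine (mu W) <= fine (mu (Omega `\` core Omega (4 * H))) + e / (2 * C + 1).
    have f1 : mu (Omega `\` core Omega (4 * H)) \is a fin_num.
      by rewrite ge0_fin_numE//; apply: muoo => //; exact: subDsetl.
    rewrite -lee_fin EFinD !fineK//; last by rewrite ge0_fin_numE//; exact: muoo.
    by apply: le_trans (measureU2 _ _ _) _ => //; rewrite leeD2l// ltW.
  apply: (le_trans (ler_wpM2l _ WW)); first by rewrite mulr_ge0.
  rewrite mulrDr lerD2l mulrCA ler_piMr ?(ltW e0)// ler_pdivrMr// mul1r lerDl.
  by [].
apply: le_trans (ler_normD _ _) _; apply: le_trans (lerD (ler_normD _ _) (lexx _)) _.
apply: le_trans (lerD (lerD (ler_normB _ _) (lexx _)) (lexx _)) _.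
by lra.
Qed.

Let bound := 2 * (d%:R * (180 * H) * T) + eps + 2 * C * fine (mu (Omega `\` core Omega (4 * H))).

Let muoo (B : set 'rV[R]_d) : measurable B -> B `<=` Omega -> (mu B < +oo)%E.
Proof. by move=> mB BO; apply: le_lt_trans Omega_lty; rewrite le_measure ?inE. Qed.

Let ui (B : set 'rV[R]_d) : measurable B -> B `<=` Omega -> mu.-integrable B (EFin \o u).
Proof.
move=> mB BO; apply: (@bounded_integrable _ _ _ _ _ _ (2 * C)) => //; first exact: muoo.
exact: measurable_funTS.
Qed.

Lemma measurable_set_estimate (A : set 'rV[R]_d) : measurable A -> A `<=` Omega ->
  `|\int[mu]_(x in A) u x| <= bound.
Proof.
move=> mA AO; apply/ler_addgt0Pr => e e0.
have C10 : 0 < 2 * C + 1 by rewrite ltr_wpDl ?mulr_ge0.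
have e2 : 0 < e / 2 by rewrite divr_gt0.
(* Regularity is applied to the restriction of [mu] to [Omega], which is finite; intersecting with
   [Omega] then leaves the excess unchanged. *)
have [V [oV AV VA]] := @finite_measure_regular _ _ (mfrestr mOmega Omega_lty) A _ mA (divr_gt0 e2 C10).
pose U := V `&` Omega.
have oU : open U by exact: openI.
have mU := open_measurable_rV oU.
have UO : U `<=` Omega by move=> x [].
have AU : A `<=` U by move=> x Ax; split; [exact: AV|exact: AO].
have mUA : measurable (U `\` A) by exact: measurableD.
have UAO : U `\` A `<=` Omega by move=> x [/UO].
have UAlt : fine (mu (U `\` A)) <= e / 2 / (2 * C + 1).
  rewrite -lee_fin fineK; last by rewrite ge0_fin_numE//; exact: muoo.
  rewrite (_ : U `\` A = (V `\` A) `&` Omega); first exact: ltW.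
  by rewrite /U !setDE setIAC.
have UE : \int[mu]_(x in U) u x = \int[mu]_(x in A) u x + \int[mu]_(x in U `\` A) u x.
  rewrite -Rintegral_setU//.
  - by rewrite setDUK.
  - by rewrite setDUK//; exact: ui.
  - by rewrite disj_set2E setDIK.
have -> : \int[mu]_(x in A) u x = \int[mu]_(x in U) u x - \int[mu]_(x in U `\` A) u x.
  by rewrite UE addrK.
apply: le_trans (ler_normB _ _) _.
apply: le_trans (lerD (open_set_estimate oU UO e2) (lexx _)) _.
rewrite -/bound -addrA lerD2l [e in leRHS]splitr lerD2l.
apply: le_trans (normr_Rintegral_le mUA (muoo mUA UAO) _ (C := 2 * C) _) _ => //.
  exact: measurable_funTS.
apply: (le_trans (ler_wpM2l _ UAlt)); first by rewrite mulr_ge0.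
by rewrite mulrCA ler_piMr ?(ltW e2)// ler_pdivrMr// mul1r lerDl.
Qed.

Lemma l1_estimate : \int[mu]_(x in Omega) `|u x| <= 2 * bound.
Proof.
pose P := Omega `&` u @^-1` `[0, +oo[%classic; pose M := Omega `\` u @^-1` `[0, +oo[%classic.
have mpre : measurable (u @^-1` `[0, +oo[%classic).
  by rewrite -[X in measurable X]setTI; exact: mu_.
have mP : measurable P by exact: measurableI.
have mM : measurable M by exact: measurableD.
have PO : P `<=` Omega by move=> x [].
have MO : M `<=` Omega by move=> x [].
have PM : P `|` M = Omega by rewrite /P /M setUIDK.
rewrite -[X in Rintegral _ X]PM Rintegral_setU//; last first.
- by rewrite disj_set2E; apply/eqP/seteqP; split => // x [[_ +] [_]].
- by rewrite PM; apply: integrable_norm; exact: ui.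
have PE : \int[mu]_(x in P) `|u x| = \int[mu]_(x in P) u x.
  apply: eq_Rintegral => x /set_mem[_]; rewrite /= in_itv/= andbT => u0.
  by rewrite ger0_norm.
have ME : \int[mu]_(x in M) `|u x| = - \int[mu]_(x in M) u x.
  rewrite -mulN1r -RintegralZl//; last exact: ui.
  apply: eq_Rintegral => x /set_mem[_]; rewrite /= in_itv/= andbT => /negP.
  by rewrite -ltNge => u0; rewrite ltr0_norm// mulN1r.
rewrite PE ME mulr2n mulrDl mul1r lerD//.
  by apply: le_trans (ler_norm _) _; exact: measurable_set_estimate.
by apply: le_trans (ler_norm _) _; rewrite normrN; exact: measurable_set_estimate.
Qed.

End set_estimate.

(** * Compactness *)

Section ultra_cauchy.
Context (R : realType) (d : nat) (Omega : set 'rV[R]_d) (oOmega : open Omega).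
Notation mu := (lebesgue_rV R d).
Hypotheses (bOmega : bounded_set Omega) (d0 : (0 < d)%N).
Let mOmega : measurable Omega := open_measurable_rV oOmega.

Lemma bounded_set_coord : exists2 L : R, 0 < L & forall x, Omega x -> forall i, `|x 0 i| <= L.
Proof.
have [M [_ MP]] := bOmega; exists (`|M| + 1); first by rewrite ltr_wpDl.
move=> x Ox i; apply: le_trans (coord_le_norm _ _) _; apply: MP => //.
by rewrite (le_lt_trans (ler_norm _))// ltrDl.
Qed.

Lemma bounded_open_lty : (mu Omega < +oo)%E.
Proof.
have [L L0 LP] := bounded_set_coord.
by apply: (@lebesgue_rV_bounded_lty _ _ _ L) => // x i /LP.
Qed.

(** The image ultrafilter clusters at some [p] of a compact segment. An ultrafilter contains the set
    of the claim or its complement, and the complement would keep [s] away from [p]. *)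
Lemma ultra_bounded_cauchy (F : set_system nat) (s : nat -> R) (K e : R) : UltraFilter F ->
  (forall n, `|s n| <= K) -> 0 < e -> exists p, \forall n \near F, `|s n - p| <= e.
Proof.
move=> FU sK e0; have cK := @segment_compact R (- K) K.
have [p [_ pF]] : (`[(- K), K]%classic `&` cluster (s @ F)) !=set0.
  apply: cK.
  suff : \forall n \near F, `[(- K), K]%classic (s n) by [].
  by apply: filterE => n; rewrite /= in_itv/= -ler_norml.
exists p; have [//|nF] := in_ultra_setVsetC [set n | `|s n - p| <= e] FU.
have [|y [/= ny py]] := pF (~` [set y | `|y - p| <= e]) (ball p e) _ (nbhsx_ballx _ _ e0).
  exact: nF.
by exfalso; apply: ny; rewrite distrC; exact: ltW.
Qed.

Variables (v : nat -> 'rV[R]_d -> R) (C T : R).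
Hypotheses (mv : forall n, measurable_fun setT (v n)) (vC : forall n x, `|v n x| <= C)
  (tvv : forall n, (tv Omega (v n) <= T%:E)%E).

Lemma coarse_bump_le1 (a H : R) N (Q : 'I_N) t : 0 < H -> coarse_bump a H Q t <= 1.
Proof.
move=> H0; apply: le_trans (sum_coarse_bump_le1 a N H0 t).
by rewrite (bigD1 Q)//= lerDl sumr_ge0// => j _; exact: coarse_bump_ge0.
Qed.

Lemma ultra_l1_cauchy (F : set_system nat) (eps : R) : UltraFilter F -> 0 < eps ->
  exists2 S, F S & forall n k, S n -> S k ->
    \int[mu]_(x in Omega) `|v n x - v k x| <= eps.
Proof.
move=> FU eps0; have Olty := bounded_open_lty.
have C0 : 0 <= C by apply: le_trans (vC 0 0).
have [L L0 LP] := bounded_set_coord.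
have C10 : 0 < 2 * C + 1 by rewrite ltr_wpDl ?mulr_ge0.
(* Three terms are made at most eps / 6 each, and [l1_estimate] doubles their sum. *)
have e6 : 0 < eps / 6 by rewrite divr_gt0.
have [r r0 Or] := core_exhaust Olty oOmega (divr_gt0 e6 C10).
have T10 : 0 < 2 * (d%:R * 180 * (`|T| + 1)) by rewrite !mulr_gt0 ?ltr0n// ltr_wpDl.
(* [r / 4] makes the boundary layer thin, and the last quotient makes the field small ([|T| + 1] is
   positive whatever the sign of [T]). The cap 1 gives a + 2 * H <= - L for the origin [a] below. *)
pose H := Num.min 1 (Num.min (r / 4) (eps / 6 / (2 * (d%:R * 180 * (`|T| + 1))))).
have H0 : 0 < H by rewrite !lt_min ltr01 !divr_gt0.
have H1 : H <= 1 by rewrite /H ge_min lexx.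
have Hr : 4 * H <= r.
  by rewrite mulrC -ler_pdivlMr// /H !ge_min lexx orbT.
have HT : 2 * (d%:R * (180 * H) * T) <= eps / 6.
  apply: (@le_trans _ _ (H * (2 * (d%:R * 180 * (`|T| + 1))))).
    rewrite (_ : 2 * _ = H * (2 * (d%:R * 180 * T))); last by ring.
    rewrite !ler_pM2l// ?mulr_gt0 ?ltr0n//.
    by rewrite (le_trans (ler_norm T))// lerDl.
  by rewrite -ler_pdivlMr// /H !ge_min lexx !orbT.
pose a := - L - 2.
pose N := (Num.trunc ((2 * L + 2) / H)).+1.
have N0 : (0 < N)%N by [].
have NH : 2 * L + 2 <= N%:R * H.
  by rewrite -ler_pdivrMr// ltW//; exact: Num.Theory.truncnS_gt.
have grid x : Omega x -> forall i, a + 2 * H <= x 0 i <= a + N%:R * H.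
  move=> Ox i; have := LP x Ox i; rewrite ler_norml /a => /andP[x1 x2].
  by apply/andP; split; lra.
have NN : 0 < N%:R ^+ d :> R by rewrite exprn_gt0// ltr0n.
pose th (Q : {ffun 'I_d -> 'I_N}) (x : 'rV[R]_d) := \prod_i coarse_bump a H (Q i) (x 0 i).
have th01 Q x : 0 <= th Q x <= 1.
  rewrite prodr_ge0 => [|i _]; last exact: coarse_bump_ge0.
  by apply: prodr_ile1 => i _; rewrite coarse_bump_ge0 coarse_bump_le1.
have mth Q : measurable_fun setT (th Q).
  apply: continuous_measurable_rV; apply: C1_continuous.
  rewrite /th; apply: (@C1_prod _ _ _ _ _ (fun i (x : 'rV[R]_d) => coarse_bump a H (Q i) (x 0 i))) => i.
  by apply: C1_coord => [t|]; [exact: derivable_coarse_bump|exact: derive_coarse_bump_continuous].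
have vthC n Q x : `|v n x * th Q x| <= C.
  have /andP[t0 t1] := th01 Q x.
  by rewrite normrM -[leRHS]mulr1 ler_pM// ger0_norm.
have vthm n Q : measurable_fun Omega (fun x => v n x * th Q x).
  by apply: measurable_funTS; exact: measurable_funM.
pose s Q n := \int[mu]_(x in Omega) (v n x * th Q x).
have sK Q n : `|s Q n| <= C * fine (mu Omega).
  by apply: normr_Rintegral_le => // x _; exact: vthC.
(* Halved because two terms of the sequence are compared through [p Q], and divided by the number
   N^d of coarse splines. *)
pose eta := eps / 6 / N%:R ^+ d / 2.
have eta0 : 0 < eta by rewrite !divr_gt0.
have /choice[p pP] : forall Q, exists p, \forall n \near F, `|s Q n - p| <= eta.
  by move=> Q; exact: ultra_bounded_cauchy (sK Q) eta0.
exists [set n | forall Q, `|s Q n - p Q| <= eta].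
  exact: filter_forall.
move=> n k Sn Sk.
have weak Q : `|\int[mu]_(x in Omega) ((v n x - v k x) * th Q x)| <= eps / 6 / N%:R ^+ d.
  under eq_Rintegral do rewrite mulrBl.
  rewrite RintegralB//; [|by apply: (@bounded_integrable _ _ _ _ _ _ C) => // x _; exact: vthC..].
  rewrite -/(s Q n) -/(s Q k) (_ : s Q n - s Q k = (s Q n - p Q) - (s Q k - p Q)); last by ring.
  apply: le_trans (ler_normB _ _) _; rewrite [leRHS]splitr; apply: lerD; [exact: Sn|exact: Sk].
have := l1_estimate oOmega Olty d0 (mv n) (mv k) (vC n) (vC k) (tvv n) (tvv k) H0 N0 grid weak.
move=> /le_trans; apply.
have : 2 * C * fine (mu (Omega `\` core Omega (4 * H))) <= eps / 6.
  apply: (@le_trans _ _ (2 * C * (eps / 6 / (2 * C + 1)))).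
    apply: ler_wpM2l; first by rewrite mulr_ge0.
    rewrite -lee_fin fineK.
      by apply: ltW; apply: Or => //; rewrite mulr_gt0.
    rewrite ge0_fin_numE//; apply: le_lt_trans Olty; rewrite le_measure ?inE//.
    by apply: measurableD => //; exact: core_measurable.
  by rewrite mulrCA ler_piMr ?(ltW e6)// ler_pdivrMr// mul1r lerDl.
by lra.
Qed.

End ultra_cauchy.

(** * Subsequences of integer-valued functions *)

Section bv_compactness.
Context (R : realType) (d : nat) (Omega : set 'rV[R]_d) (oOmega : open Omega).
Notation mu := (lebesgue_rV R d).
Hypotheses (bOmega : bounded_set Omega) (d0 : (0 < d)%N).
Let mOmega : measurable Omega := open_measurable_rV oOmega.

Lemma measurable_neq_set (f g : 'rV[R]_d -> R) : measurable_fun setT f -> measurable_fun setT g ->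
  measurable (Omega `&` [set x | f x != g x]).
Proof.
move=> mf mg.
have := measurable_neqe mOmega (f := EFin \o f) (g := EFin \o g).
by apply; apply/measurable_EFinP; exact: measurable_funTS.
Qed.

(** Distinct integers are at distance at least 1, so [|f - g|] dominates the indicator of the
    set. *)
Lemma mu_neq_le_l1 (f g : 'rV[R]_d -> R) (C e : R) :
  measurable_fun setT f -> measurable_fun setT g ->
  (forall x, `|f x| <= C) -> (forall x, `|g x| <= C) ->
  (forall x, exists z : int, f x = z%:~R) -> (forall x, exists z : int, g x = z%:~R) ->
  \int[mu]_(x in Omega) `|f x - g x| <= e ->
  (mu (Omega `&` [set x | f x != g x]) <= e%:E)%E.
Proof.
move=> mf mg fC gC fz gz fge; have Olty := bounded_open_lty oOmega bOmega.
have mN := measurable_neq_set mf mg.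
set N := Omega `&` _ in mN *.
have NO : N `<=` Omega by exact: subIsetl.
have Nlty : (mu N < +oo)%E by apply: le_lt_trans Olty; rewrite le_measure ?inE.
rewrite -(fineK (x := mu N)) ?lee_fin ?ge0_fin_numE//.
apply: le_trans fge; rewrite -[leLHS]mul1r -Rintegral_cst// (Rintegral_patch _ _ NO).
have fgi : mu.-integrable Omega (EFin \o (fun x => f x - g x)).
  apply: (@bounded_integrable _ _ _ _ _ _ (C + C)) => //.
    by apply: measurable_funTS; exact: measurable_funB.
  by move=> x _; apply: le_trans (ler_normB _ _) _; rewrite lerD.
apply: le_Rintegral => //.
- apply: (@bounded_integrable _ _ _ _ _ _ 1) => //.
    by apply/measurable_restrict => //; exact: measurable_cst.
  by move=> x _; rewrite patchE; case: ifP => _; rewrite ?normr1 ?normr0.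
- exact: integrable_norm.
- move=> x Ox; rewrite patchE; case: ifPn => [/set_mem[_ /=]|_]; last exact: normr_ge0.
  have [y ->] := fz x; have [z ->] := gz x.
  by rewrite eqr_int => yz; rewrite -intrB -intr_norm ler1z -gtz0_ge1 normr_gt0 subr_eq0.
Qed.

(** Increments of L^1 norm at most 2^-k change the value on a set of measure at most 2^-k; [E k]
    collects all changes from [k] on, with measure bounded by the geometric tail 2 / 2^k.
    Exceptional sets, rather than a mode of convergence, serve both the L^2 distance and the test
    integrals. *)
Lemma bv_integer_compact (v : nat -> 'rV[R]_d -> R) (C T : R) :
  (forall n, measurable_fun setT (v n)) -> (forall n x, `|v n x| <= C) ->
  (forall n x, exists z : int, v n x = z%:~R) -> (forall n, (tv Omega (v n) <= T%:E)%E) ->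
  exists (s : nat -> nat) (w : 'rV[R]_d -> R) (E : nat -> set 'rV[R]_d),
    [/\ forall k, (k <= s k)%N, measurable_fun setT w,
      forall k, measurable (E k),
      forall k x, Omega x -> ~ E k x -> w x = v (s k) x &
      forall k, (mu (E k) <= (2 / (2 ^ k)%:R)%:E)%E].
Proof.
move=> mv vC vz tvv.
have [F [FU Foo]] := ultraFilterLemma eventually_filter.
have /choice[S SP] : forall k, exists S, F S /\ forall n l, S n -> S l ->
    \int[mu]_(x in Omega) `|v n x - v l x| <= ((2 ^ k)%:R^-1 : R).
  move=> k; have [|S FS SP] := ultra_l1_cauchy oOmega bOmega d0 mv vC tvv (eps := (2 ^ k)%:R^-1) FU.
    by rewrite invr_gt0 ltr0n expn_gt0.
  by exists S.
(* Membership in all earlier sets puts [s k] and [s k.+1] together in [S k]. *)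
have /choice[s sP] : forall k, exists n, (k <= n)%N /\ forall j, (j <= k)%N -> S j n.
  move=> k; suff : F ([set n | (k <= n)%N] `&` [set n | forall j, (j <= k)%N -> S j n]).
    by move=> /filter_ex[n [kn nS]]; exists n.
  apply: filterI; first by apply: Foo; exists k.
  elim: k => [|k IH].
    by apply: filterS (SP 0%N).1 => n Sn j; rewrite leqn0 => /eqP ->.
  apply: filterS2 IH (SP k.+1).1 => n IH Sn j; rewrite leq_eqVlt => /predU1P[->//|].
  exact: IH.
pose N k := Omega `&` [set x | v (s k) x != v (s k.+1) x].
have mN k : measurable (N k) by exact: measurable_neq_set.
have Nle k : (mu (N k) <= ((2 ^ k)%:R^-1)%:E)%E.
  apply: mu_neq_le_l1 (vC _) (vC _) (vz _) (vz _) _ => //.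
  by apply: (SP k).2; [exact: (sP k).2|apply: (sP k.+1).2].
pose E k := \bigcup_l N (k + l)%N.
(* An upper limit is measurable everywhere, also at points where the sequence does not settle. *)
pose w x := fine (limn_esup (fun k => (v (s k) x)%:E)).
exists s, w, E; split.
- by move=> k; exact: (sP k).1.
- apply: measurableT_comp => //.
  by apply: measurable_fun_limn_esup => n; apply/measurable_EFinP.
- by move=> k; apply: bigcup_measurable => l _; exact: mN.
- move=> k x Ox xE.
  have vE l : v (s (k + l)%N) x = v (s k) x.
    elim: l => [|l IH]; first by rewrite addn0.
    rewrite addnS -IH; apply/eqP; apply: contrapT => /negP ne; apply: xE.
    by exists l => //; split => //=; rewrite eq_sym.
  have : (v (s n) x)%:E @[n --> \oo] --> (v (s k) x)%:E.
    apply: (@cvg_near_cst _ _ _ _ _ _).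
    by exists k => // n /= kn; rewrite -(subnKC kn) vE.
  by rewrite /w => /cvg_limn_einf_sup[_ ->].
- move=> k.
  have mE : measurable (E k) by apply: bigcup_measurable => l _; exact: mN.
  apply: (@le_trans _ _ (\sum_(0 <= l <oo) mu (N (k + l)%N))%E).
    by apply: measure_sigma_subadditive.
  apply: (le_trans _ (@epsilon_trick0 R (2 / (2 ^ k)%:R) xpredT _)); last by rewrite divr_ge0.
  apply: lee_nneseries => // l _; apply: le_trans (Nle _) _.
  rewrite lee_fin expnD expnS !natrM le_eqVlt; apply/orP; left; apply/eqP; field.
  by rewrite !pnatr_eq0 !expn_eq0.
Qed.

End bv_compactness.

(** * Elements of L^2 *)

Section L2_tools.
Context (R : realType) (d : nat) (Omega : set 'rV[R]_d) (oOmega : open Omega).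
Notation mu := (lebesgue_rV R d).
Hypothesis Omega_lty : (mu Omega < +oo)%E.
Let mOmega : measurable Omega := open_measurable_rV oOmega.
Notation muO := (lebesgue_on oOmega).

Lemma lebesgue_onE (A : set 'rV[R]_d) : muO A = mu (A `&` Omega).
Proof. by []. Qed.

Lemma ae_lebesgue_on (P : set 'rV[R]_d) :
  {ae muO, forall x, P x} <-> {ae mu, forall x, Omega x -> P x}.
Proof.
split=> -[A [mA A0 PA]].
  exists (A `&` Omega); split; first exact: measurableI.
  - exact: A0.
  - by move=> x /= /not_implyP[Ox Px]; split => //; exact: PA.
exists (A `|` ~` Omega); split.
- by apply: measurableU => //; exact: measurableC.
- rewrite lebesgue_onE setIUl setICl setU0.
  apply/eqP; rewrite eq_le measure_ge0 andbT -A0 le_measure ?inE//.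
  exact: measurableI.
- move=> x /= Px; have [Ox|Ox] := pselect (Omega x); last by right.
  by left; apply: PA => /= /(_ Ox).
Qed.

Lemma L2_measurable (v : L2 oOmega) : measurable_fun setT (v : 'rV[R]_d -> R).
Proof.
by move=> mT Y mY; exact: (@measurable_funPT _ _ _ _ (repr (LebesgueSpace.sort v))).
Qed.

Lemma tv_ae (f g : 'rV[R]_d -> R) : measurable_fun setT f -> measurable_fun setT g ->
  {ae mu, forall x, Omega x -> f x = g x} -> tv Omega f = tv Omega g.
Proof.
move=> mf mg fg; rewrite /tv; congr ereal_sup; apply: eq_imagel => phi [phi1 _].
have mdiv : measurable_fun setT (divergence phi).
  by apply: continuous_measurable_rV; exact: divergence_continuous phi1.
apply: ae_eq_integral => //.
- by apply/measurable_EFinP; apply: measurable_funTS; exact: measurable_funM.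
- by apply/measurable_EFinP; apply: measurable_funTS; exact: measurable_funM.
- by apply: filterS fg => x fgx Ox; rewrite fgx.
Qed.

Lemma bounded_finite_norm (f w : 'rV[R]_d -> R) (C p : R) : 0 < p ->
  measurable_fun setT f -> measurable_fun setT w ->
  (forall x, `|w x| <= C) -> {ae muO, forall x, f x = w x} -> finite_norm muO p%:E f.
Proof.
move=> p0 mf mw wC fw; rewrite /finite_norm unlock; apply: poweR_lty.
have mpow (h : 'rV[R]_d -> R) : measurable_fun setT h ->
    measurable_fun setT (fun x => `|(EFin \o h) x| `^ p)%E.
  move=> mh; rewrite (_ : (fun x => _) = EFin \o (fun x => `|h x| `^ p))//.
  apply/measurable_EFinP; apply: (@measurableT_comp _ _ _ _ _ _ (@powR R ^~ p)) => //.
  exact: measurableT_comp.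
rewrite (ae_eq_integral (fun x => `|(EFin \o w) x| `^ p)%E)//.
- apply: (@le_lt_trans _ _ (\int[muO]_x (C `^ p)%:E)%E).
    apply: ge0_le_integral => //.
    + by move=> x _; exact: poweR_ge0.
    + exact: mpow.
    + by move=> x _; rewrite /= lee_fin ge0_ler_powR ?nnegrE ?(ltW p0)// (le_trans _ (wC x)).
  rewrite integral_cst// lebesgue_onE setTI lte_mul_pinfty ?lee_fin ?powR_ge0//.
- exact: mpow.
- exact: mpow.
- by apply: filterS fw => x /= -> .
Qed.

(** The coercion picks its own representative of the class of [w], so equality is recovered only
    almost everywhere, from [reprK]. *)
Lemma L2_of_bounded (w : 'rV[R]_d -> R) (C : R) : measurable_fun setT w ->
  (forall x, `|w x| <= C) ->
  exists v : L2 oOmega, {ae mu, forall x, Omega x -> v x = w x}.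
Proof.
move=> mw wC.
have mw' : measurable_fun setT (w : 'rV[R]_d -> measurableTypeR R).
  by move=> mT Y mY; exact: mw.
pose wm : {mfun 'rV[R]_d >-> measurableTypeR R} := 
  HB.pack (w : 'rV[R]_d -> measurableTypeR R) (isMeasurableFun.Build _ _ _ _ (w : 'rV[R]_d -> measurableTypeR R) mw').
pose q : {mfun_ muO, 'rV[R]_d >-> measurableTypeR R} := (\pi_(aeEqMfun (measurableTypeR R) muO) wm)%qT.
have qw : {ae muO, forall x, q x = w x}.
  have : (repr q == wm %[mod aeEqMfun (measurableTypeR R) muO])%qT by rewrite reprK.
  by rewrite eqmodE => /asboolP; apply: filterS => x /(_ I).
have fq : finite_norm muO 2%:E q.
  apply: (bounded_finite_norm (C := C) _ _ mw wC qw) => //.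
  by move=> mT Y mY; exact: (@measurable_funPT _ _ _ _ (repr q)).
pose v : L2 oOmega := HB.pack q (isFinLebesgue.Build _ _ _ _ _ (lee1n 2) q fq).
by exists v; apply/ae_lebesgue_on.
Qed.

(** The functions differ by at most 2 * C, and only on [E], so the squared distance is at most (2 *
    C)^2 * delta. Small exceptional sets thus give closeness in the topology where [F] is lower
    semicontinuous. *)
Lemma L2_ball (v1 v2 : L2 oOmega) (w1 w2 : 'rV[R]_d -> R) (E : set 'rV[R]_d) (C delta e : R) :
  measurable E ->
  {ae mu, forall x, Omega x -> v1 x = w1 x} -> {ae mu, forall x, Omega x -> v2 x = w2 x} ->
  (forall x, `|w1 x| <= C) -> (forall x, `|w2 x| <= C) ->
  (forall x, Omega x -> ~ E x -> w1 x = w2 x) -> (mu E <= delta%:E)%E ->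
  (2 * C) ^+ 2 * delta < e ^+ 2 -> 0 < e -> ball v1 e v2.
Proof.
move=> mE vw1 vw2 w1C w2C w12 Edelta de e0; rewrite ballEmdist/= /mdist/=.
have C0 : 0 <= C by exact: le_trans (w1C 0).
pose f x := `|v1 x - v2 x| `^ 2.
have mf : measurable_fun setT (EFin \o f).
  apply/measurable_EFinP; apply: (@measurableT_comp _ _ _ _ _ _ (@powR R ^~ 2)) => //.
  by apply: measurableT_comp => //; apply: measurable_funB; exact: L2_measurable.
have vw : {ae muO, forall x, v1 x = w1 x /\ v2 x = w2 x}.
  apply/ae_lebesgue_on; apply: filterS2 vw1 vw2 => x e1 e2 Ox.
  by split; [exact: e1|exact: e2].
(* [w1] and [w2] are compared on [Omega] only; its complement is null for [muO]. *)
pose A := E `|` ~` Omega.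
have mA : measurable A by apply: measurableU => //; exact: measurableC.
have fle : (\int[muO]_x (EFin \o f) x <= ((2 * C) ^+ 2 * delta)%:E)%E.
  rewrite (ae_eq_integral ((EFin \o f) \_ A))//; last 2 first.
  - by apply/measurable_restrict => //; exact: measurable_funTS.
  - apply: filterS vw => x [e1 e2] _; rewrite patchE; case: ifPn => //.
    rewrite notin_setE => /not_orP[xE /contrapT xO].
    by rewrite /= /f e1 e2 w12// subrr normr0 powR0// pnatr_eq0.
  rewrite -integral_mkcond.
  rewrite (eq_integral (fun x => `|(EFin \o f) x|)%E); last first.
    by move=> x _; rewrite gee0_abs// lee_fin powR_ge0.
  apply: le_trans (integral_le_bound ((2 * C) ^+ 2)%:E _ _ _ _) _ => //.
  - exact: measurable_funTS.
  - by rewrite lee_fin sqr_ge0.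
  - apply: filterS vw => x [e1 e2] _; rewrite gee0_abs ?lee_fin ?powR_ge0//.
    rewrite /f e1 e2 powR_mulrn// ler_sqr ?nnegrE ?mulr_ge0//.
    rewrite mulr2n mulrDl mul1r; apply: le_trans (ler_normB _ _) _.
    by rewrite lerD.
  - rewrite [in leRHS]EFinM; apply: lee_wpmul2l; rewrite ?lee_fin ?sqr_ge0//; rewrite lebesgue_onE.
    rewrite setIUl setICl setU0; apply: le_trans Edelta.
    by rewrite le_measure ?inE//; exact: measurableI.
have f0 : (0 <= \int[muO]_x (EFin \o f) x)%E.
  by apply: integral_ge0 => x _; rewrite lee_fin powR_ge0.
have ffin : (\int[muO]_x (EFin \o f) x)%E \is a fin_num.
  by rewrite ge0_fin_numE// (le_lt_trans fle) ?ltry.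
rewrite /Lspace_dist unlock.
rewrite (_ : (\int[_]_x _)%E = (\int[muO]_x (EFin \o f) x)%E)//.
rewrite -(fineK ffin) poweR_EFin /= powR12_sqrt ?fine_ge0//.
rewrite -[ltRHS](gtr0_norm e0) -sqrtr_sqr ltr_sqrt ?exprn_gt0//.
by apply: le_lt_trans de; rewrite -lee_fin fineK.
Qed.

End L2_tools.

(** * Existence of minimizers *)

Section snap.
Context (R : realType) (M : nat) (nu : 'I_M -> int) (i0 : 'I_M).

Definition levels : set R := [set t | exists i, t = (nu i)%:~R].

(** Composition with this retraction onto the levels turns a constraint valid almost everywhere on
    [Omega] into one valid at every point, as the uniform bounds and the integrality require. The
    indicator form reduces its measurability to that of [levels]. *)
Definition snap (t : R) : R := t * \1_levels t + (nu i0)%:~R * (1 - \1_levels t).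

Lemma snap_id t : levels t -> snap t = t.
Proof. by move=> tl; rewrite /snap indicE mem_set// subrr mulr0 addr0 mulr1. Qed.

Lemma snap_levels t : levels (snap t).
Proof.
have [tl|tl] := pselect (levels t); first by rewrite snap_id.
by rewrite /snap indicE memNset// mulr0 add0r subr0 mulr1; exists i0.
Qed.

Lemma snap_measurable d (T : measurableType d) (f : T -> R) : measurable_fun setT f ->
  measurable_fun setT (snap \o f).
Proof.
move=> mf; have ml : measurable levels.
  rewrite (_ : levels = \bigcup_(i in [set: 'I_M]) [set (nu i)%:~R]).
    by apply: fin_bigcup_measurable => // i _; exact: measurable_set1.
  by apply/seteqP; split => [t [i ->]|t [i _ ->]]; exists i.
have mi : measurable_fun setT (\1_levels : R -> R) by exact: measurable_indic.
apply: measurableT_comp => //; apply: measurable_funD; apply: measurable_funM => //.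
exact: measurable_funB.
Qed.

Lemma levels_bounded : exists C : R, forall t, levels t -> `|t| <= C.
Proof.
exists (\sum_i `|(nu i)%:~R|) => _ [i ->].
by rewrite (bigD1 i)//= lerDl sumr_ge0.
Qed.

End snap.

Section tv_nonneg.
Context (R : realType) (d : nat) (Omega : set 'rV[R]_d).

Lemma C1c_cst0 : C1c Omega (cst 0 : 'rV[R]_d -> 'rV[R]_d).
Proof.
have [d0 c0] := @C1_cst R 'rV[R]_d 'rV[R]_d 0.
have S0 : [set x : 'rV[R]_d | cst (0 : 'rV[R]_d) x != 0] = set0.
  by apply/seteqP; split => // x /=; rewrite eqxx.
by split => //; rewrite S0 closure0; [exact: compact0|].
Qed.

Lemma tv_ge0 (u : 'rV[R]_d -> R) : (0 <= tv Omega u)%E.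
Proof.
apply: ereal_sup_ubound; exists (cst 0).
  split; first exact: C1c_cst0.
  by move=> s _; rewrite /enorm big1 ?sqrtr0// => i _; rewrite mxE expr0n.
apply: integral0_eq => x _; rewrite /divergence big1 ?mulr0// => i _.
by rewrite (_ : (fun y => _) = cst 0) ?derive_cst//; apply/funext => y; rewrite mxE.
Qed.

End tv_nonneg.

(** * Passage to the limit in a test integral *)

Section limit.
Context (R : realType) (d : nat) (Omega : set 'rV[R]_d) (oOmega : open Omega).
Notation mu := (lebesgue_rV R d).
Hypothesis Omega_lty : (mu Omega < +oo)%E.
Let mOmega : measurable Omega := open_measurable_rV oOmega.

Lemma Rintegral_close (w1 w2 g : 'rV[R]_d -> R) (E : set 'rV[R]_d) (C K delta : R) :
  measurable_fun setT w1 -> measurable_fun setT w2 -> measurable_fun setT g -> measurable E ->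
  (forall x, `|w1 x| <= C) -> (forall x, `|w2 x| <= C) -> (forall x, `|g x| <= K) ->
  (forall x, Omega x -> ~ E x -> w1 x = w2 x) -> (mu E <= delta%:E)%E ->
  \int[mu]_(x in Omega) (w1 x * g x) <=
  \int[mu]_(x in Omega) (w2 x * g x) + 2 * C * K * delta.
Proof.
move=> m1 m2 mg mE w1C w2C gK w12 Edelta.
have C0 : 0 <= C by exact: le_trans (w1C 0).
have K0 : 0 <= K by exact: le_trans (gK 0).
have wi (w : 'rV[R]_d -> R) : measurable_fun setT w -> (forall x, `|w x| <= C) ->
    mu.-integrable Omega (EFin \o (fun x => w x * g x)).
  move=> mw wC; apply: (@bounded_integrable _ _ _ _ _ _ (C * K)) => //.
    by apply: measurable_funTS; exact: measurable_funM.
  by move=> x _; rewrite normrM ler_pM.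
rewrite addrC -lerBlDr -RintegralB//; [|exact: wi..].
pose B := E `&` Omega.
have mB : measurable B by exact: measurableI.
have BO : B `<=` Omega by move=> x [].
have Ble : (mu B <= delta%:E)%E by apply: le_trans Edelta; rewrite le_measure ?inE//; exact: subIsetl.
have Blty : (mu B < +oo)%E by rewrite (le_lt_trans Ble)// ltry.
rewrite (_ : \int[mu]_(x in Omega) (w1 x * g x - w2 x * g x) =
    \int[mu]_(x in Omega) (((fun x => w1 x * g x - w2 x * g x) \_ B) x)); last first.
  apply: eq_Rintegral.
  move=> x /set_mem Ox; rewrite patchE; case: ifPn => //; rewrite notin_setE => xB.
  by rewrite w12 ?subrr// => xE; apply: xB.
rewrite -(Rintegral_patch _ _ BO); apply: le_trans (ler_norm _) _.
apply: le_trans (normr_Rintegral_le mB Blty _ (C := 2 * C * K) _) _.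
- by apply: measurable_funTS; apply: measurable_funB; exact: measurable_funM.
- move=> x _; rewrite -mulrBl normrM ler_pM//.
  rewrite mulr2n mulrDl mul1r; apply: le_trans (ler_normB _ _) _.
  by rewrite lerD.
- rewrite ler_wpM2l ?mulr_ge0// -lee_fin fineK// ge0_fin_numE//.
Qed.

End limit.

Unset Implicit Arguments.
Set Strict Implicit.
Set Printing Implicit Defensive.

Theorem proposition2p3 (R : realType) (alpha : R) (alpha_gt0 : 0 < alpha)
    (d M : nat) (d_ge1 : (1 <= d)%N) (M_ge1 : (1 <= M)%N)
    (Omega : set 'rV[R]_d) (oOmega : open Omega)
    (bOmega : bounded_set Omega) (cOmega : connected Omega)
    (lOmega : lipschitz_boundary Omega)
    (nu : 'I_M -> int) (nu_lt : forall i j : 'I_M, (i < j)%N -> nu i < nu j)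
    (F : L2 oOmega -> R)
    (F_lsc : lower_semicontinuous (fun v => (F v)%:E))
    (F_lb : has_lbound (range F)) :
  exists vbar : L2 oOmega,
    [/\ bv oOmega vbar,
        feasible Omega nu vbar &
        forall v : L2 oOmega, feasible Omega nu v ->
          ((F vbar)%:E + alpha%:E * tv Omega vbar
             <= (F v)%:E + alpha%:E * tv Omega v)%E].
Proof.
have Olty := bounded_open_lty oOmega bOmega.
pose i0 := Ordinal M_ge1.
have [C levC] := @levels_bounded R M nu.
pose sn := @snap R M nu i0.
have snC t : `|sn t| <= C by apply: levC; exact: snap_levels.
have snz t : exists z : int, sn t = z%:~R.
  by have [i sni] := snap_levels nu i0 t; exists (nu i).
have msn (f : 'rV[R]_d -> R) : measurable_fun setT f -> measurable_fun setT (sn \o f).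
  exact: snap_measurable.
have C0 : 0 <= C by exact: le_trans (snC 0).
have [b bF] := F_lb.
have bF' v : b <= F v by apply: bF; exists v.
have tv0 (u : 'rV[R]_d -> R) : (0 <= tv Omega u)%E by exact: tv_ge0.
have ae_snap (v : L2 oOmega) : feasible Omega nu v ->
    {ae lebesgue_rV R d, forall x, Omega x -> v x = (sn \o v) x}.
  apply: filterS => x + Ox => /(_ Ox)[i vi].
  by rewrite /= /sn snap_id//; exists i.
have tv_snap (v : L2 oOmega) : feasible Omega nu v -> tv Omega v = tv Omega (sn \o v).
  move=> fv; apply: tv_ae => //; [exact: L2_measurable| |exact: ae_snap].
  by apply: msn; exact: L2_measurable.
pose good (v : L2 oOmega) := feasible Omega nu v /\ (tv Omega v < +oo)%E.
(* Restricting to finite total variation makes the objective real-valued, so that its infimum is a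
   real number. *)
pose J (v : L2 oOmega) := F v + alpha * fine (tv Omega v).
have tv_fin v : good v -> tv Omega v = (fine (tv Omega v))%:E.
  by move=> [_ voo]; rewrite fineK// ge0_fin_numE.
(* A constant level: a feasible competitor of total variation 0, so the infimum is over a nonempty
   set. *)
have [vc vcE] := @L2_of_bounded R d Omega oOmega Olty (cst (sn 0)) C (measurable_cst _) (fun=> snC 0).
have vc_good : good vc.
  split.
    apply: filterS vcE => x + Ox => /(_ Ox) ->.
    exact: (snap_levels nu i0 0).
  rewrite (tv_ae oOmega _ _ vcE) ?tv_cst//; exact: L2_measurable.
have J_lb : has_inf [set J v | v in good].
  split; first by exists (J vc), vc.
  exists b => _ [v _ <-]; apply: le_trans (bF' v) _.
  by rewrite lerDl; apply: mulr_ge0; [exact: ltW|exact: fine_ge0].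
pose m := inf [set J v | v in good].
have m_le v : good v -> m <= J v by move=> gv; apply: ge_inf; [exact: J_lb.2|exists v].
have /choice[v vP] : forall n : nat, exists v, good v /\ J v < m + n.+1%:R^-1.
  move=> n; have [|_ [v gv <-] vm] := inf_adherent (E := [set J v | v in good]) (eps := n.+1%:R^-1) _ J_lb.
    by rewrite invr_gt0.
  by exists v.
(* From [J (v n) < m + 1] and [b <= F (v n)]. *)
pose T := (m + 1 - b) / alpha.
have vT n : (tv Omega (sn \o v n) <= T%:E)%E.
  have [gv Jv] := vP n; rewrite -tv_snap; last exact: gv.1.
  rewrite tv_fin// lee_fin ler_pdivlMr// mulrC.
  have n1 : n.+1%:R^-1 <= 1 :> R by rewrite invf_le1 ?ler1n.
  have := bF' (v n); move: Jv n1; rewrite /J.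
  by move: (F _) (alpha * _) (_^-1) => p q t; lra.
have [s [w [E [ks mw mE wE Ele]]]] := bv_integer_compact oOmega bOmega d_ge1
  (v := fun n => sn \o v n) (fun n => msn _ (@L2_measurable _ _ _ _ _)) (fun n x => snC _)
  (fun n x => snz _) vT.
(* [w] is uncontrolled off [Omega] and on the intersection of the [E k]; after composition with [sn]
   it takes levels everywhere. *)
have swE k x : Omega x -> ~ E k x -> (sn \o w) x = (sn \o v (s k)) x.
  move=> Ox Ex; rewrite /= (wE _ _ Ox Ex) /= {1}/sn snap_id//; exact: snap_levels.
have [vbar vbarE] := @L2_of_bounded R d Omega oOmega Olty (sn \o w) C (msn _ mw) (fun x => snC _).
have tvbar : tv Omega vbar = tv Omega (sn \o w).
  by apply: (tv_ae oOmega _ _ vbarE); [exact: L2_measurable|exact: msn].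
have fbar : feasible Omega nu vbar.
  by apply: filterS vbarE => x + Ox => /(_ Ox) ->; exact: snap_levels.
have pow0 (c e : R) : 0 < e -> exists K, forall k, (K <= k)%N -> c * (2 / (2 ^ k)%:R) < e.
  move=> e0; exists (Num.trunc (`|c| * 2 / e)).+1 => k Kk.
  rewrite mulrA ltr_pdivrMr ?ltr0n ?expn_gt0//.
  apply: (@le_lt_trans _ _ (`|c| * 2)); first by rewrite ler_pM2r// ler_norm.
  rewrite [e * _]mulrC -ltr_pdivrMr//; apply: lt_le_trans (Num.Theory.truncnS_gt _) _.
  by rewrite ler_nat; apply: leq_trans Kk (ltnW _); exact: ltn_expl.
(* [F] and the integral against one fixed field are compared with the same term [v (s k)]. The three
   thirds of [e] pay for the semicontinuity of [F], for the change of the integral, and for the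
   distance of that term from the infimum. *)
have main phi e : tv_fields Omega phi -> 0 < e ->
    F vbar + alpha * \int[lebesgue_rV R d]_(x in Omega) ((sn \o w) x * divergence phi x) <= m + e.
  move=> [phi1 phi_le1] e0.
  have [K divK] := divergence_bounded phi1.
  have mdiv : measurable_fun setT (divergence phi).
    by apply: continuous_measurable_rV; exact: divergence_continuous phi1.
  have e3 : 0 < e / 3 by rewrite divr_gt0.
  have [|V nV VF] := F_lsc vbar (F vbar - e / 3); first by rewrite lte_fin ltrBlDr ltrDl.
  have /nbhs_ballP[r /= r0 rV] := nV.
  have [K1 K1P] := pow0 ((2 * C) ^+ 2) (r ^+ 2) (exprn_gt0 _ r0).
  have [K2 K2P] := pow0 (alpha * (2 * C * K)) (e / 3) e3.
  (* One summand for each demand: the L^2 ball, the test integral, and 1 / (s k + 1) <= e / 3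
     through [k <= s k]. *)
  pose k := (K1 + K2 + (Num.trunc (e / 3)^-1))%N.
  have K1k : (K1 <= k)%N by rewrite /k -addnA leq_addr.
  have K2k : (K2 <= k)%N by rewrite /k addnAC leq_addl.
  have [gv Jv] := vP (s k).
  have Fk : F vbar - e / 3 < F (v (s k)).
    rewrite -lte_fin; apply: VF; apply: rV.
    apply: (L2_ball (mE k) vbarE (ae_snap _ gv.1) _ _ (swE k) (Ele k) (K1P _ K1k) r0) => x;
      exact: snC.
  have Ik := Rintegral_close oOmega Olty (msn _ mw) (msn _ (@L2_measurable _ _ _ _ (v (s k)))) mdiv
    (mE k) (fun x => snC _) (fun x => snC _) divK (swE k) (Ele k).
  have Tk : \int[lebesgue_rV R d]_(x in Omega) ((sn \o v (s k)) x * divergence phi x) <=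
      fine (tv Omega (v (s k))).
    rewrite -lee_fin -tv_fin// tv_snap; last exact: gv.1.
    apply: ereal_sup_ubound; exists phi => //.
    rewrite /Rintegral fineK//; apply: integrable_fin_num; first exact: open_measurable_rV.
    apply: (@bounded_integrable _ _ _ _ _ _ (C * K)) => //.
    - exact: open_measurable_rV.
    - apply: measurable_funTS; apply: measurable_funM => //.
      by apply: msn; exact: L2_measurable.
    - by move=> x _; rewrite normrM ler_pM// snC.
  have nk : (s k).+1%:R^-1 <= e / 3.
    rewrite invf_ple ?posrE//; apply: le_trans (ltW (Num.Theory.truncnS_gt _)) _.
    by rewrite ler_nat ltnS (leq_trans _ (ks k))// leq_addl.
  have := ler_wpM2l (ltW alpha_gt0) Ik; rewrite mulrDr [alpha * (_ * (2 / _))]mulrA.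
  have := ler_wpM2l (ltW alpha_gt0) Tk; have := K2P _ K2k.
  move: Fk Jv nk; rewrite /J; move: (F _) (F _) ((s k).+1%:R^-1).
  move: (alpha * Rintegral _ _ _) (alpha * Rintegral _ _ _) (alpha * fine _).
  move: (alpha * (2 * C * K) * _) => x1 x2 x3 x4 x5 x6 x7; lra.
(* The supremum over the fields is taken only now; it gives at once that the total variation of
   [vbar] is finite and that [J vbar <= m]. *)
have tvbar_le : (tv Omega vbar <= ((m - F vbar) / alpha)%:E)%E.
  rewrite tvbar; apply: ge_ereal_sup => _ [phi phiP <-].
  have [phi1 _] := phiP.
  have [K divK] := divergence_bounded phi1.
  have wi : (lebesgue_rV R d).-integrable Omega (EFin \o (fun x => (sn \o w) x * divergence phi x)).
    apply: (@bounded_integrable _ _ _ _ _ _ (C * K)) => //.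
    - exact: open_measurable_rV.
    - apply: measurable_funTS; apply: measurable_funM; first exact: msn.
      by apply: continuous_measurable_rV; exact: divergence_continuous phi1.
    - by move=> x _; rewrite normrM ler_pM// snC.
  rewrite -(fineK (integrable_fin_num (open_measurable_rV oOmega) wi)) lee_fin.
  rewrite ler_pdivlMr// mulrC lerBrDl; apply/ler_addgt0Pr => e e0; exact: main.
have gbar : good vbar by split => //; rewrite (le_lt_trans tvbar_le)// ltry.
exists vbar; split => //.
- split; last exact: gbar.2.
  rewrite inE; apply/andP; split; rewrite inE/=; first exact: L2_measurable.
  apply: (@bounded_finite_norm _ _ _ _ Olty _ (sn \o w) C 1) => //.
  + exact: L2_measurable.
  + exact: msn.
  + by move=> x; exact: snC.
  + exact/ae_lebesgue_on.
(* A competitor of infinite total variation has value +oo because [alpha] is positive; the others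
   are [good]. *)
- move=> u fu; have [uoo|] := ltP (tv Omega u) +oo%E; last first.
    by rewrite leye_eq => /eqP ->; rewrite gt0_muley ?lte_fin// addey// leey.
  have gu : good u by [].
  rewrite (tv_fin _ gbar) (tv_fin _ gu) -!EFinM -!EFinD lee_fin.
  apply: le_trans (m_le _ gu).
  move: tvbar_le; rewrite (tv_fin _ gbar) lee_fin ler_pdivlMr// mulrC => ?; lra.
Qed.
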